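(* Under the standing assumptions (A1)–(A6) of the abstract setting, let $c\in\mathcal I$. If $d''(c)>0$, then the bound state $U_c$ is conditionally orbitally stable in the following sense. For any $R>0$ and $\rho>0$ there exists $\rho_0>0$ such that, if $u:[0,t_0)\to\mathcal B_R^{\mathbb W}$ is a solution of $\frac{du}{dt}=J(u)DE(u)$ with initial data $u_0\in\mathcal U_{\rho_0}^{\mathbb X}$, then $u(t)\in\mathcal U_\rho^{\mathbb X}$ for all $t\in[0,t_0)$.
   Context: Abstract setting. $\mathbb W\hookrightarrow\mathbb V\hookrightarrow\mathbb X$ (continuous embeddings), $\mathbb X$ a real Hilbert space with inner product $(\cdot,\cdot)_{\mathbb X}$, $\mathbb V,\mathbb W$ reflexive Banach spaces; $I:\mathbb X\to\mathbb X^*$, $Iu=(u,\cdot)_{\mathbb X}$; $\langle\cdot,\cdot\rangle$ is the duality pairing (biduals identified); $\mathcal O\subset\mathbb X$ is open. (A1) There are $\theta\in(0,1]$, $C>0$ with $\|u\|_{\mathbb V}^3\le C\|u\|_{\mathbb X}^{2+\theta}\|u\|_{\mathbb W}^{1-\theta}$ for all $u\in\mathbb W$. (A2) $\hat J:\mathcal D(\hat J)\subset\mathbb X^*\to\mathbb X$ is closed linear, densely defined and injective. For $u\in\mathcal O\cap\mathbb V$, $B(u)\in\mathrm{Lin}(\mathbb X)$ is bounded and bijective, and $u\mapsto B(u)$ is in $C^1(\mathcal O\cap\mathbb V;\mathrm{Lin}(\mathbb X))\cap C^1(\mathcal O\cap\mathbb W;\mathrm{Lin}(\mathbb W))$. $J(u):=B(u)\hat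 J$ satisfies $\langle J(u)v,w\rangle=-\langle v,J(u)w\rangle$ for all $v,w\in\mathcal D(\hat J)$. (A3) $E,P\in C^3(\mathcal O\cap\mathbb V;\mathbb R)$ and there are $\nabla E,\nabla P\in C^0(\mathcal O\cap\mathbb V;\mathbb X^* )$ such that $\nabla E(u),\nabla P(u)$ extend $DE(u),DP(u)$. A solution of $\frac{du}{dt}=J(u)DE(u)$, $u(0)=u_0$, on $[0,t_0)$ is $u\in C^0([0,t_0);\mathcal O\cap\mathbb W)$ with $u(0)=u_0$, $\frac d{dt}\langle u(t),w\rangle=-\langle\nabla E(u(t)),J(u(t))w\rangle$ in the distributional sense on $(0,t_0)$ for all $w\in\mathcal D(\hat J)$, and with $E(u(t))$, $P(u(t))$ conserved. (A4) $T(s):\mathbb X\to\mathbb X$, $s\in\mathbb R$, are affine with linear part $dT(s)u=T(s)u-T(s)0$, and: (i) $\mathcal O,\mathbb V,\mathbb W$ are invariant under $T$, and $I^{-1}\mathcal D(\hat J)$ under $dT$. (ii) $T(0)=\mathrm{Id}$, $T(s+r)=T(s)T(r)$. (iii) $dT(s)$ is unitary on $\mathbb X$ and isometric on $\mathbb V$ and $\mathbb W$. (iv) $T$ is strongly continuous on $\mathbb X,\mathbb V,\mathbb W$. (v) $T(\cdot)0\in C^3(\mathbb R;\mathbb W)$ and $\|T(s)0\|_{\mathbb W}\le\omega(\|T(s)0\|_{\mathbb X})$ for an increasing $\omega:[0,\infty)\to[0,\infty)$. (vi) $\hat JI\,dT(s)=dT(s)\hat JI$ and $dT(s)B(u)=B(T(s)u)dT(s)$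 for $s\in\mathbb R$, $u\in\mathcal O\cap\mathbb V$. (vii) $T'(0)u=\lim_{s\to0}s^{-1}(T(s)u-u)=dT'(0)u+T'(0)0$ is the generator, with dense domain $\mathcal D(T'(0))\subset\mathbb X$ where the limit exists in $\mathbb X$; $\mathcal D(T'(0)|_{\mathbb V})$, $\mathcal D(T'(0)|_{\mathbb W})$ are the dense subspaces of $\mathbb V$, $\mathbb W$ where it exists in $\mathbb V$, $\mathbb W$. For $u\in\mathcal D(T'(0)|_{\mathbb V})\cap\mathcal O$: $\nabla P(u)\in\mathcal D(\hat J)$ and $T'(0)u=J(u)\nabla P(u)$. Moreover $\hat JI\,dT'(0)=dT'(0)\hat JI$. (viii) $\mathcal D(T'(0)|_{\mathbb W})\cap\mathrm{Rng}\,\hat J$ is dense in $\mathbb X$. (ix) $E(T(s)u)=E(u)$ for $u\in\mathcal O\cap\mathbb V$, $s\in\mathbb R$. (A5) $\mathcal I\subset\mathbb R$ is a nonempty open interval and for each $c\in\mathcal I$, $U_c\in\mathcal O\cap\mathbb W$ is a bound state, i.e. $u(t)=T(ct)U_c\in C^1(\mathbb R;\mathcal O\cap\mathbb W)$ is a solution. (i) $c\mapsto U_c\in\mathcal O\cap\mathbb W$ is $C^1$. (ii) $U_c\in\mathcal D(T'''(0))\cap\mathcal D(\hat JIT'(0))$ (with $T^{(k)}(s)U$ denoting the $k$-th derivative of $s\mapsto T(s)U$ in $\mathbb X$), and $U_c,\ \hat JIT'(0)U_c\in\mathcal D(T'(0)|_{\mathbb W})$. (iii) $T'(0)U_c\ne0$.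 (iv) Either $s\mapsto T(s)U_c$ is periodic or $\liminf_{|s|\to\infty}\|T(s)U_c-U_c\|_{\mathbb X}>0$. (A6) With $E_c:=E-cP$, the operator $D^2E_c(U_c)\in\mathrm{Lin}(\mathbb V,\mathbb V^* )$ extends uniquely to a bounded $H_c:\mathbb X\to\mathbb X^*$ such that $I^{-1}H_c$ is self-adjoint and $\mathrm{spec}(I^{-1}H_c)=\{-\mu_c^2\}\cup\{0\}\cup\Sigma_c$, where $-\mu_c^2<0$ is a simple eigenvalue with unit eigenvector $\chi_c$, $0$ is a simple eigenvalue with eigenvector $T'(0)U_c$, and $\Sigma_c\subset(0,\infty)$ is bounded away from $0$. Notation: $d(c)=E(U_c)-cP(U_c)$, $c\in\mathcal I$; $\mathcal U_\rho^{\mathbb X}=\{u\in\mathcal O:\inf_s\|u-T(s)U_c\|_{\mathbb X}<\rho\}$; $\mathcal B_R^{\mathbb W}=\{u\in\mathcal O\cap\mathbb W:\inf_s\|T(s)u\|_{\mathbb W}<R\}$. *)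

(* Defs.v *)
From HB Require Import structures.
From mathcomp Require Import all_boot all_order all_algebra.
From mathcomp Require Import all_classical all_reals all_analysis.
From mathcomp Require Import ring.
Set Implicit Arguments.
Unset Strict Implicit.
Unset Printing Implicit Defensive.
Import Order.TTheory GRing.Theory Num.Theory.
Import numFieldNormedType.Exports.
Local Open Scope classical_set_scope.
Local Open Scope ring_scope.

(* blin U V is the normed space of bounded linear maps U -> V, with the
   operator norm. *)
Section BoundedLinear.
Variables (R : realType) (U V : normedModType R).

Definition is_blin : {pred U -> V} :=
  [pred f | `[< linear f /\ continuous f >]].

Record blin := Blin { blin_fun :> U -> V ; blinP : blin_fun \in is_blin }.

HB.instance Definition _ := [isSub for blin_fun].
HB.instance Definition _ := [Choice of blin by <:].

Fact is_blin_submod : submod_closed is_blin.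
Proof.
split; first by rewrite inE; split;
  [move=> a x y /=; rewrite /GRing.zero/= scaler0 addr0 | exact: cst_continuous].
move=> a f g; rewrite !inE => -[lf cf] [lg cg]; split.
- move=> b x y; rewrite !fctE lf lg !scalerDr !scalerA [a * b]mulrC.
  by rewrite addrACA.
- by move=> x; apply: continuousD; [apply: continuousZl_tmp; exact: cf | exact: cg].
Qed.
HB.instance Definition _ :=
  GRing.isSubmodClosed.Build R (U -> V) is_blin is_blin_submod.
HB.instance Definition _ := [SubChoice_isSubLmodule of blin by <:].

Lemma blin_linear (f : blin) : linear f.
Proof. by have := blinP f; rewrite inE => -[]. Qed.

Lemma blin_continuous (f : blin) : continuous f.
Proof. by have := blinP f; rewrite inE => -[]. Qed.

HB.instance Definition _ (f : blin) :=
  GRing.isLinear.Build R U V _ (blin_fun f) (@blin_linear f).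

Definition opnorm (f : blin) : R := sup [set `|f x| | x in [set x | `|x| <= 1]].

Lemma opnorm_has_sup (f : blin) :
  has_sup [set `|f x| | x in [set x | `|x| <= 1]].
Proof.
split; first by exists `|f 0|, 0 => //=; rewrite normr0.
have /linear_boundedP/pinfty_ex_gt0[M M0 fM] :=
  @continuous_linear_bounded _ _ _ 0 f (@blin_continuous f 0).
exists M => _ [x /= x1 <-]; apply: le_trans (fM x) _.
by rewrite -[leRHS]mulr1 ler_pM2l.
Qed.

Lemma opnorm_ub (f : blin) x : `|x| <= 1 -> `|f x| <= opnorm f.
Proof.
by move=> x1; apply: (sup_upper_bound (opnorm_has_sup f)); exists x.
Qed.

Lemma opnorm_le (f : blin) M :
  (forall x, `|x| <= 1 -> `|f x| <= M) -> opnorm f <= M.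
Proof.
move=> fM; apply: ge_sup; first exact: (opnorm_has_sup f).1.
by move=> _ [x /= x1 <-]; exact: fM.
Qed.

Lemma opnorm_ge0 (f : blin) : 0 <= opnorm f.
Proof. by apply: le_trans (@opnorm_ub f 0 _); rewrite ?normr0. Qed.

Lemma opnormD (f g : blin) : opnorm (f + g) <= opnorm f + opnorm g.
Proof.
apply: opnorm_le => x x1; apply: le_trans (ler_normD _ _) _.
by apply: lerD; exact: opnorm_ub.
Qed.

Lemma opnormZ (a : R) (f : blin) : opnorm (a *: f) = `|a| * opnorm f.
Proof.
have le b (h : blin) : opnorm (b *: h) <= `|b| * opnorm h.
  apply: opnorm_le => x x1.
  have -> : (b *: h) x = b *: h x by [].
  by rewrite normrZ ler_wpM2l// opnorm_ub.
apply/eqP; rewrite eq_le le /=; have [->|a0] := eqVneq a 0.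
  by rewrite normr0 mul0r opnorm_ge0.
rewrite -ler_pdivlMl ?normr_gt0// -normfV; apply: le_trans (le _ _).
by rewrite scalerA mulVf// scale1r.
Qed.

Lemma opnorm_eq0 (f : blin) : opnorm f = 0 -> f = 0.
Proof.
move=> f0; apply/val_inj/funext => x /=.
have f1 y : `|y| <= 1 -> f y = 0.
  by move=> /(opnorm_ub f); rewrite f0 normr_le0 => /eqP.
have [->|x0] := eqVneq x 0; first by rewrite linear0.
rewrite -[x in LHS](scalerKV (_ : `|x| != 0)) ?normr_eq0//.
by rewrite linearZ/= f1 ?scaler0// normfZV.
Qed.

HB.instance Definition _ :=
  Lmodule_isNormed.Build R blin opnormD opnormZ opnorm_eq0.

End BoundedLinear.
Arguments blin {R} U V.


Section Differentiation.
Variable R : realType.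

(* The Frechet derivative of f at x; it is 0 if f is not differentiable at x. *)
Definition frechet (U V : normedModType R) (f : U -> V) (x : U) : blin U V :=
  xget 0 [set L : blin U V | is_diff x f L].

(* f is of class C^k on the open set A. *)
Fixpoint Ck (U V : normedModType R) (k : nat) (A : set U) (f : U -> V) : Prop :=
  match k with
  | 0 => forall x, A x -> {for x, continuous f}
  | k'.+1 => (forall x, A x -> differentiable f x) /\ Ck k' A (frechet f)
  end.

(* The derivative of order k of the curve g exists at s. *)
Fixpoint derivable_n (Y : normedModType R) (k : nat) (g : R -> Y) (s : R) :
    Prop :=
  match k with
  | 0 => True
  | k'.+1 => (\forall r \near s, derivable_n k' g r) /\
             derivable (derive1n k' g) s 1
  end.

Definition test_function (A : set R) (phi : R -> R) : Prop :=
  (forall k t, derivable (derive1n k phi) t 1) /\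
  exists K : set R, [/\ compact K, K `<=` A & forall t, ~ K t -> phi t = 0].

(* d/dt f = g on the open set A, in the sense of distributions. *)
Definition distributional_derivative (A : set R) (f g : R -> R) : Prop :=
  forall phi, test_function A phi ->
    \int[lebesgue_measure]_(t in A) (f t * derive1 phi t) =
    - \int[lebesgue_measure]_(t in A) (g t * phi t).

End Differentiation.

Section Hilbert.
Variables (R : realType) (X : normedModType R).

Record inner_product := InnerProduct {
  ip :> X -> X -> R ;
  ip_linear : forall a x y z, ip (a *: x + y) z = a * ip x z + ip y z ;
  ip_sym : forall x y, ip x y = ip y x ;
  ip_norm : forall x, ip x x = `|x| ^+ 2 }.

Variable p : inner_product.

Lemma ip_polar x y : p x y = 4^-1 * (`|x + y| ^+ 2 - `|x - y| ^+ 2).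
Proof.
have D a b c : p (a + b) c = p a c + p b c.
  by have := ip_linear p 1 a b c; rewrite scale1r mul1r.
have N a b : p (- a) b = - p a b.
  have p0 : p 0 b = 0 by have := D 0 0 b; rewrite addr0 => /esym/eqP;
    rewrite -subr_eq0 addrK => /eqP.
  by apply/eqP; rewrite -subr_eq0 opprK -D addNr p0.
rewrite -!(ip_norm p) !D !N (ip_sym p x (x + y)) (ip_sym p y (x + y)).
rewrite (ip_sym p x (x - y)) (ip_sym p y (x - y)) !D !N (ip_sym p y x).
by field.
Qed.

Lemma ip_blin x : p x \in @is_blin R X R.
Proof.
rewrite inE; split.
  by move=> a y z; rewrite ip_sym ip_linear !(ip_sym p _ x).
rewrite (_ : p x = fun y => 4^-1 * (`|x + y| ^+ 2 - `|x - y| ^+ 2)); last first.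
  by apply/funext => y; exact: ip_polar.
have sq (z : X) (f : X -> X) : f y @[y --> z] --> f z ->
    `|f y| ^+ 2 @[y --> z] --> `|f z| ^+ 2.
  by rewrite expr2 => fz; apply: cvgM; exact: cvg_norm.
move=> y; apply: cvgMl_tmp; apply: cvgB.
  by apply: (sq _ (fun y => x + y)); apply: cvgD; [exact: cvg_cst|exact: cvg_id].
by apply: (sq _ (fun y => x - y)); apply: cvgB; [exact: cvg_cst|exact: cvg_id].
Qed.

(* The map I : X -> X^*, I u = (u, .). *)
Definition riesz (x : X) : blin X R := Blin (ip_blin x).

End Hilbert.

(* Unbounded operators are given by a domain and a total function, whose values
   off the domain are irrelevant; two of them are equal when the domains agree
   and the functions agree there. *)
Definition same_operator (A B : Type) (D1 : set A) (f1 : A -> B)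
    (D2 : set A) (f2 : A -> B) : Prop :=
  D1 = D2 /\ forall x, D1 x -> f1 x = f2 x.

Section Spectrum.
Variables (R : realType) (X : normedModType R).

(* All operators considered are self-adjoint, so that the spectrum of the
   complexification is real and the multiplicity of an eigenvalue is the
   dimension of its eigenspace. *)
Definition spectrum (A : X -> X) : set R :=
  [set l | ~ exists S : blin X X,
     cancel (fun x => A x - l *: x) S /\ cancel S (fun x => A x - l *: x)].

Definition simple_eigenvalue (A : X -> X) (l : R) (e : X) : Prop :=
  e != 0 /\ [set x | A x = l *: x] = range (fun a : R => a *: e).

End Spectrum.

Section Generator.
Variables (R : realType) (Y : normedModType R) (S : R -> Y -> Y).

Definition gen_dom : set Y :=
  [set y | cvg ((s^-1 *: (S s y - y)) @[s --> (0 : R)^'])].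

Definition gen (y : Y) : Y := lim ((s^-1 *: (S s y - y)) @[s --> (0 : R)^']).

End Generator.

Definition reflexive_space (R : realType) (Y : normedModType R) : Prop :=
  forall F : blin (blin Y R) R, exists y : Y, forall f : blin Y R, F f = f y.

(* The data of the abstract setting.  The maps B, E, P, gradE, gradP, U are
   total, but only their values on O /\ V (resp. O /\ W, resp. I) matter, and
   Jhat is only considered on Jdom.  BW, TV, TW are the restrictions of B to
   operators on W and of T to V and W; assumption2 and assumption4 impose that
   these restrictions exist, and they are then determined by B and T. *)
Record setting (R : realType) := Setting {
  Xs : completeNormedModType R ;
  Vs : completeNormedModType R ;
  Ws : completeNormedModType R ;
  ipX : inner_product Xs ;
  embV : blin Vs Xs ;
  embWV : blin Ws Vs ;
  Oset : set Xs ;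
  Jdom : set (blin Xs R) ;
  Jhat : blin Xs R -> Xs ;
  Bop : Vs -> blin Xs Xs ;
  BopW : Ws -> blin Ws Ws ;
  E : Vs -> R ;
  P : Vs -> R ;
  gradE : Vs -> blin Xs R ;
  gradP : Vs -> blin Xs R ;
  T : R -> Xs -> Xs ;
  TV : R -> Vs -> Vs ;
  TW : R -> Ws -> Ws ;
  Iset : set R ;
  U : R -> Ws }.

Arguments Oset {R} s _.
Arguments Jdom {R} s _.
Arguments Jhat {R} s _.
Arguments Bop {R} s _.
Arguments BopW {R} s _.
Arguments E {R} s _.
Arguments P {R} s _.
Arguments gradE {R} s _.
Arguments gradP {R} s _.
Arguments T {R} s _ _.
Arguments TV {R} s _ _.
Arguments TW {R} s _ _.
Arguments Iset {R} s _.
Arguments U {R} s _.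

Section Assumptions.
Variables (R : realType) (S : setting R).

Local Notation X := (Xs S).
Local Notation V := (Vs S).
Local Notation W := (Ws S).
Local Notation I := (riesz (ipX S)).

Definition embW (w : W) : X := embV S (embWV S w).
Definition OV : set V := [set v | Oset S (embV S v)].
Definition OW : set W := [set w | Oset S (embW w)].

(* J(u) = B(u) Jhat, with domain Jdom. *)
Definition J (u : V) (w : blin X R) : X := Bop S u (Jhat S w).

(* The linear part of T(s). *)
Definition dT (s : R) (x : X) : X := T S s x - T S s 0.
Definition dTV (s : R) (v : V) : V := TV S s v - TV S s 0.
Definition dTW (s : R) (w : W) : W := TW S s w - TW S s 0.

(* T'(0) on X, and its domains in X, V and W. *)
Definition T' : X -> X := gen (T S).
Definition domT' : set X := gen_dom (T S).
Definition domT'V : set V := gen_dom (TV S).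
Definition domT'W : set W := gen_dom (TW S).
Definition dT' : X -> X := gen dT.
Definition domdT' : set X := gen_dom dT.

(* A solution on the set of times D, without initial condition. *)
Definition is_solution (D : set R) (u : R -> W) : Prop :=
  [/\ forall t, D t -> OW (u t),
      {within D, continuous u},
      forall w, Jdom S w ->
        distributional_derivative (interior D)
          (fun t => w (embW (u t)))
          (fun t => - gradE S (embWV S (u t)) (J (embWV S (u t)) w)),
      forall s t, D s -> D t -> E S (embWV S (u s)) = E S (embWV S (u t)) &
      forall s t, D s -> D t -> P S (embWV S (u s)) = P S (embWV S (u t))].

Definition time_interval (t0 : \bar R) : set R :=
  [set t | 0 <= t /\ (t%:E < t0)%E].

Definition solution (t0 : \bar R) (u0 : W) (u : R -> W) : Prop :=
  is_solution (time_interval t0) u /\ u 0 = u0.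

Definition assumption_spaces : Prop :=
  [/\ injective (embV S), injective (embWV S),
      reflexive_space V, reflexive_space W & open (Oset S)].

Definition assumption1 : Prop :=
  exists theta C : R, [/\ 0 < theta, theta <= 1, 0 < C &
    forall u : W, `|embWV S u| ^+ 3 <=
      C * `|embW u| `^ (2 + theta) * `|u| `^ (1 - theta)].

Definition assumption2 : Prop :=
  [/\ [/\ forall (a : R) f g, Jdom S f -> Jdom S g ->
            Jdom S (a *: f + g) /\
            Jhat S (a *: f + g) = a *: Jhat S f + Jhat S g,
          closed [set p : blin X R * X | Jdom S p.1 /\ p.2 = Jhat S p.1],
          dense (Jdom S) &
          forall f g, Jdom S f -> Jdom S g -> Jhat S f = Jhat S g -> f = g],
      forall u, OV u -> bijective (Bop S u),
      forall u, OW u ->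
        forall w, embW (BopW S u w) = Bop S (embWV S u) (embW w),
      Ck 1 OV (Bop S) /\ Ck 1 OW (BopW S) &
      forall u, OV u -> forall v w, Jdom S v -> Jdom S w ->
        w (J u v) = - v (J u w)].

Definition assumption3 : Prop :=
  [/\ Ck 3 OV (E S) /\ Ck 3 OV (P S),
      Ck 0 OV (gradE S) /\ Ck 0 OV (gradP S),
      forall u, OV u -> forall v, gradE S u (embV S v) = frechet (E S) u v &
      forall u, OV u -> forall v, gradP S u (embV S v) = frechet (P S) u v].

Definition assumption4_i : Prop :=
  [/\ forall s x, Oset S x -> Oset S (T S s x),
      forall s v, embV S (TV S s v) = T S s (embV S v),
      forall s w, embW (TW S s w) = T S s (embW w) &
      forall s x, Jdom S (I x) -> Jdom S (I (dT s x))].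

Definition assumption4_ii : Prop :=
  (forall x, T S 0 x = x) /\ forall s r x, T S (s + r) x = T S s (T S r x).

Definition assumption4_iii : Prop :=
  [/\ forall s x y, ipX S (dT s x) (dT s y) = ipX S x y,
      forall s y, exists x, dT s x = y,
      forall s v, `|dTV s v| = `|v| &
      forall s w, `|dTW s w| = `|w|].

Definition assumption4_iv : Prop :=
  [/\ forall x, continuous (fun s => T S s x),
      forall v, continuous (fun s => TV S s v) &
      forall w, continuous (fun s => TW S s w)].

Definition assumption4_v : Prop :=
  Ck 3 setT (fun s => TW S s 0) /\
  exists omega : R -> R,
    [/\ forall r, 0 <= r -> 0 <= omega r,
        forall r r', 0 <= r -> r <= r' -> omega r <= omega r' &
        forall s, `|TW S s 0| <= omega `|T S s 0| ].

Definition assumption4_vi : Prop :=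
  (forall s, same_operator
     [set x | Jdom S (I (dT s x))] (fun x => Jhat S (I (dT s x)))
     [set x | Jdom S (I x)] (fun x => dT s (Jhat S (I x)))) /\
  (forall s u, OV u ->
     forall x, dT s (Bop S u x) = Bop S (TV S s u) (dT s x)).

Definition assumption4_vii : Prop :=
  [/\ [/\ dense domT', dense domT'V & dense domT'W],
      forall u, domT'V u -> OV u ->
        Jdom S (gradP S u) /\ T' (embV S u) = J u (gradP S u) &
      same_operator
        [set x | domdT' x /\ Jdom S (I (dT' x))]
        (fun x => Jhat S (I (dT' x)))
        [set x | Jdom S (I x) /\ domdT' (Jhat S (I x))]
        (fun x => dT' (Jhat S (I x)))].

Definition assumption4_viii : Prop :=
  dense ((embW @` domT'W) `&` (Jhat S @` Jdom S)).

Definition assumption4_ix : Prop :=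
  forall u, OV u -> forall s, E S (TV S s u) = E S u.

Definition assumption4 : Prop :=
  (forall s, linear (dT s)) /\
  [/\ assumption4_i, assumption4_ii, assumption4_iii & assumption4_iv] /\
  [/\ assumption4_v, assumption4_vi, assumption4_vii, assumption4_viii &
      assumption4_ix].

Definition bound_state (c : R) (u : W) : Prop :=
  [/\ OW u, Ck 1 setT (fun t => TW S (c * t) u) &
      is_solution setT (fun t => TW S (c * t) u)].

(* The sets of the form {s | M < |s|} generate this filter. *)
Definition abs_pinfty : set (set R) := pinfty_nbhs R `&` ninfty_nbhs R.

Definition assumption5 : Prop :=
  [/\ [/\ Iset S !=set0, open (Iset S) & is_interval (Iset S)],
      forall c, Iset S c -> bound_state c (U S c),
      Ck 1 (Iset S) (U S) &
      forall c, Iset S c -> let u := embW (U S c) in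
      [/\ [/\ derivable_n 3 (fun s => T S s u) 0,
              domT' u, Jdom S (I (T' u)),
              domT'W (U S c) &
              exists2 w, domT'W w & embW w = Jhat S (I (T' u))],
          T' u != 0 &
          (exists2 p, 0 < p & forall s, T S (s + p) u = T S s u) \/
          (0 < limf_einf (fun s => `|T S s u - u|%:E) abs_pinfty)%E]].

Definition Ec (c : R) (u : V) : R := E S u - c * P S u.

Definition extends_D2Ec (c : R) (H : blin X (blin X R)) : Prop :=
  forall v w : V, H (embV S v) (embV S w) =
    (frechet (frechet (Ec c)) (embWV S (U S c)) : blin V (blin V R)) v w.

(* A below is I^-1 H_c, and -mu^2, chi, Sigma are the negative eigenvalue, its
   eigenvector and the positive part of the spectrum. *)
Definition assumption6 : Prop :=
  forall c, Iset S c -> exists H : blin X (blin X R),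
    [/\ extends_D2Ec c H,
        forall H', extends_D2Ec c H' -> H' = H &
        exists (A : blin X X) (mu : R) (chi : X) (Sigma : set R),
          [/\ forall x, I (A x) = H x,
              forall x y, ipX S (A x) y = ipX S x (A y),
              spectrum A = [set - mu ^+ 2] `|` [set 0] `|` Sigma,
              [/\ - mu ^+ 2 < 0, `|chi| = 1 &
                  simple_eigenvalue A (- mu ^+ 2) chi] /\
              simple_eigenvalue A 0 (T' (embW (U S c))) &
              exists2 delta : R, 0 < delta & forall l, Sigma l -> delta <= l]].

Definition moment (c : R) : R :=
  E S (embWV S (U S c)) - c * P S (embWV S (U S c)).

(* The sets U_rho^X and B_r^W. *)
Definition tube (c rho : R) : set X :=
  [set x | Oset S x /\
    inf [set `|x - T S s (embW (U S c))| | s in [set: R]] < rho].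

Definition ball_mod_T (r : R) : set W :=
  [set w | OW w /\ inf [set `|TW S s w| | s in [set: R]] < r].

Definition conditionally_orbitally_stable (c : R) : Prop :=
  forall r rho : R, 0 < r -> 0 < rho -> exists2 rho0 : R, 0 < rho0 &
    forall (t0 : \bar R) (u0 : W) (u : R -> W), (0 < t0)%E ->
      solution t0 u0 u ->
      (forall t, time_interval t0 t -> ball_mod_T r (u t)) ->
      tube c rho0 (embW u0) ->
      forall t, time_interval t0 t -> tube c rho (embW (u t)).

End Assumptions.

(* Main.v *)
Require Import Defs.
From mathcomp Require Import all_boot all_order all_algebra.
From mathcomp Require Import all_classical all_reals all_analysis.
From mathcomp Require Import ring lra.
Set Implicit Arguments.
Unset Strict Implicit.
Unset Printing Implicit Defensive.
Import Order.TTheory GRing.Theory Num.Theory.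
Import numFieldNormedType.Exports.
Local Open Scope classical_set_scope.
Local Open Scope ring_scope.

(** The orbit of U_c is stable because it is a nondegenerate minimum, modulo the
    group T, of E - c P plus a multiple of (P - P(U_c))^2.  This functional
    (lyapunov) is conserved along solutions and invariant under the group, the
    latter because P is invariant (P_invariant) as E is.  It therefore suffices
    to bound it from below, near the orbit and on sets bounded in W modulo the
    group, by a multiple of the squared distance to the orbit in X; then the
    distance, which is continuous in time, cannot grow beyond a small value
    (orbital_stability).

    For the lower bound, U_c is a critical point of E_c = E - c P (critical):
    the equation of the bound state says that the derivative of E_c vanishes on
    a dense set.  Differentiating this in c shows that the second variation A
    of E_c at U_c sends y, the derivative of c -> U_c, to the gradient of P
    (D2Ec_dU), and that (A y, y) = - d''(c) < 0 (moment_derive2).  Since A has a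
    single negative eigenvalue, a kernel spanned by tau = T'(0) U_c and
    otherwise a spectral gap, a direction y of negative energy makes (A v, v)
    coercive up to multiples of (A y, v)^2 and (tau, v)^2
    (constrained_coercivity).  The first square is paid for by the penalty
    (P - P(U_c))^2.  The second one is negligible if v is the difference of a
    state and an almost nearest point of the orbit (almost_minimizer).

    The second variation controls only the norm of X, whereas E and P are
    smooth in V.  The Taylor remainders are cubic in V, and cubic terms in V are
    negligible against the square of a small X norm on bounded sets of W
    (interpolation); the bound in W modulo the group carries over to the
    difference with the orbit (orbit_W_bound).

    The spectral input is elementary.  If the interval (a, b) is free of
    spectrum then (A - a)(A - b) >= 0 (gap_form_ge), because the infimum of the
    numerical range is an approximate eigenvalue (form_ge_continuation).  From
    this, a lower bound a of the form of A on an invariant subspace without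
    eigenvectors for a improves to b (form_ge_on_raise). *)

(** * Bounded operators and symmetric forms *)

Section RealLemmas.
Variable R : realType.
Implicit Types x y : R.

Lemma lt_of_sqr_lt x y : 0 <= y -> x ^+ 2 < y ^+ 2 -> x < y.
Proof.
move=> y0; apply: contraTT; rewrite -!leNgt => yx.
by rewrite ler_pXn2r// nnegrE (le_trans y0).
Qed.

Lemma le_of_sqr_le x y : 0 <= y -> x ^+ 2 <= y ^+ 2 -> x <= y.
Proof.
move=> y0; apply: contraTT; rewrite -!ltNge => yx.
by rewrite ltr_pXn2r// nnegrE (le_trans y0)// ltW.
Qed.

End RealLemmas.

Section BoundedOperators.
Variables (R : realType) (U V : normedModType R) (f : blin U V).

Lemma blinB x y : f (x - y) = f x - f y.
Proof. exact: linearB. Qed.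

Lemma blinZ a x : f (a *: x) = a *: f x.
Proof. exact: linearZ. Qed.

Lemma blin_le_opnorm x : `|f x| <= opnorm f * `|x|.
Proof.
have [->|x0] := eqVneq x 0; first by rewrite linear0 !normr0 mulr0.
have nx : 0 < `|x| by rewrite normr_gt0.
rewrite -ler_pdivrMr//.
have := @opnorm_ub R U V f (`|x|^-1 *: x); rewrite linearZ/= !normrZ.
by rewrite normfV normr_id mulVf ?gt_eqF// mulrC; apply.
Qed.

Lemma blin_bounded : exists2 K : R, 0 < K & forall x, `|f x| <= K * `|x|.
Proof.
exists (opnorm f + 1); first by rewrite ltr_wpDl// opnorm_ge0.
move=> x; apply: le_trans (blin_le_opnorm x) _.
by rewrite ler_wpM2r// lerDl.
Qed.

End BoundedOperators.

Section InnerProduct.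
Variables (R : realType) (X : normedModType R) (p : inner_product X).
Implicit Types x y z : X.

Lemma ipDl x y z : p (x + y) z = p x z + p y z.
Proof. by have := ip_linear p 1 x y z; rewrite scale1r mul1r. Qed.

Lemma ip0l z : p 0 z = 0.
Proof. by have := ipDl 0 0 z; rewrite addr0 => ?; lra. Qed.

Lemma ipZl a x z : p (a *: x) z = a * p x z.
Proof. by have := ip_linear p a x 0 z; rewrite addr0 ip0l addr0. Qed.

Lemma ipNl x z : p (- x) z = - p x z.
Proof. by rewrite -scaleN1r ipZl mulN1r. Qed.

Lemma ipDr x y z : p z (x + y) = p z x + p z y.
Proof. by rewrite !(ip_sym p z) ipDl. Qed.

Lemma ip0r z : p z 0 = 0.
Proof. by rewrite ip_sym ip0l. Qed.

Lemma ipZr a x z : p z (a *: x) = a * p z x.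
Proof. by rewrite !(ip_sym p z) ipZl. Qed.

Lemma ipNr x z : p z (- x) = - p z x.
Proof. by rewrite !(ip_sym p z) ipNl. Qed.

Definition ipE := (ipDl, ipDr, ipNl, ipNr, ipZl, ipZr).

Lemma ip_ext x y : (forall z, p x z = p y z) -> x = y.
Proof.
move=> xy; apply/eqP; rewrite -subr_eq0 -normr_eq0 -sqrf_eq0 -(ip_norm p).
by rewrite ipDl ipNl xy subrr.
Qed.

Lemma ip_ge0 x : 0 <= p x x.
Proof. by rewrite ip_norm sqr_ge0. Qed.

Lemma ip_continuous x : continuous (p x).
Proof. exact: (@blin_continuous R X _ (riesz p x)). Qed.

Definition symmetric_op (B : X -> X) := forall x y, p (B x) y = p x (B y).

(** Paired with z, the map B moves to the other side, where the inner
    product is linear. *)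
Lemma symmetric_opDZ B a x y : symmetric_op B -> B (a *: x + y) = a *: B x + B y.
Proof. by move=> sB; apply: ip_ext => z; rewrite sB !ipE !sB. Qed.

Lemma discr_le (a b c : R) : 0 <= a -> 0 <= c ->
  (forall t, 0 <= a + t * b *+ 2 + t ^+ 2 * c) -> b ^+ 2 <= a * c.
Proof.
move=> a0 c0 h; have [c00|cn0] := eqVneq c 0.
  have [->|b0] := eqVneq b 0; first by rewrite expr0n /= mulr_ge0.
  by have := h (- (a + 1) / b); rewrite c00 mulr0 addr0 mulfVK// => h1; lra.
have : 0 <= (a + (- b / c) * b *+ 2 + (- b / c) ^+ 2 * c) * c.
  by rewrite mulr_ge0.
have -> : (a + (- b / c) * b *+ 2 + (- b / c) ^+ 2 * c) * c = a * c - b ^+ 2.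
  by field.
by rewrite subr_ge0.
Qed.

(** The polynomial t -> (B (x + t y), x + t y) is nonnegative, so its
    discriminant is not positive. Positivity is asked on a subspace because
    the operators considered later are positive only away from their lowest
    eigenvectors. *)
Lemma form_cauchy_schwarz (B : X -> X) (Y : set X) x y : symmetric_op B ->
  (forall a x y, Y x -> Y y -> Y (a *: x + y)) ->
  (forall x, Y x -> 0 <= p (B x) x) -> Y x -> Y y ->
  p (B x) y ^+ 2 <= p (B x) x * p (B y) y.
Proof.
move=> sB Ylin B0 Yx Yy; apply: discr_le => [||t]; [exact: B0|exact: B0|].
have := B0 _ (Ylin t _ _ Yy Yx).
rewrite symmetric_opDZ// !ipE (sB y x) (ip_sym p y); congr (_ <= _); ring.
Qed.

Lemma ip_cauchy_schwarz x y : `|p x y| <= `|x| * `|y|.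
Proof.
have := @form_cauchy_schwarz id setT x y; rewrite !ip_norm -exprMn => h.
rewrite -(@ler_pXn2r _ 2)// ?nnegrE ?mulr_ge0// real_normK ?num_real//.
by apply: h => // z _; exact: ip_ge0.
Qed.

End InnerProduct.

(** * Lower bounds of symmetric operators and spectral gaps *)

Section Spectral.
Variables (R : realType) (X : normedModType R) (p : inner_product X).
Implicit Types (B : X -> X) (x y : X).
Local Notation sym := (symmetric_op p).

Definition bounded_below B := exists2 k : R, 0 < k & forall x, k * `|x| <= `|B x|.

Definition form_ge B (q : R) := forall x, q * `|x| ^+ 2 <= p (B x) x.

Definition spectral_shift B (q : R) x := B x - q *: x.

Definition bounded_op B := exists2 K : R, 0 < K & forall x, `|B x| <= K * `|x|.

Lemma shift_sym B q : sym B -> sym (spectral_shift B q).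
Proof. by move=> sB x y; rewrite /spectral_shift !ipE sB. Qed.

Lemma shift_bounded B q : bounded_op B -> bounded_op (spectral_shift B q).
Proof.
move=> [K K0 BK]; exists (K + `|q|); first by rewrite ltr_pwDl.
move=> x; apply: le_trans (ler_normB _ _) _.
by rewrite mulrDl normrZ lerD.
Qed.

Lemma form_ge_shift B q e : form_ge (spectral_shift B q) e <-> form_ge B (q + e).
Proof.
by split=> h x; have := h x; rewrite /spectral_shift !ipE ip_norm => ?; lra.
Qed.

Lemma comp_bounded B C : bounded_op B -> bounded_op C -> bounded_op (B \o C).
Proof.
move=> [K K0 BK] [L L0 CL]; exists (K * L); first exact: mulr_gt0.
by move=> x; apply: le_trans (BK _) _; rewrite -mulrA ler_pM2l.
Qed.

Lemma comp_bounded_below B C : bounded_below B -> bounded_below C ->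
  bounded_below (B \o C).
Proof.
move=> [K K0 BK] [L L0 CL]; exists (K * L); first exact: mulr_gt0.
by move=> x; apply: le_trans _ (BK _); rewrite -mulrA ler_pM2l.
Qed.

Lemma bounded_belowP B e : 0 < e -> form_ge B e -> bounded_below B.
Proof.
move=> e0 Be; exists e => // x; have [->|x0] := eqVneq x 0.
  by rewrite normr0 mulr0.
rewrite -(@ler_pM2r _ `|x|) ?normr_gt0// -mulrA -expr2.
apply: le_trans (Be x) (le_trans (ler_norm _) (ip_cauchy_schwarz _ _ _)).
Qed.

(** The Cauchy-Schwarz inequality of the form of B, for x and B x. *)
Lemma nonneg_op_norm B : sym B -> bounded_op B -> form_ge B 0 ->
  exists2 K : R, 0 < K & forall x, `|B x| ^+ 2 <= K * p (B x) x.
Proof.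
move=> sB [K K0 BK] B0; exists K => // x.
have B0' : forall x, setT x -> 0 <= p (B x) x.
  by move=> y _; have := B0 y; rewrite mul0r.
have := form_cauchy_schwarz (x := x) (y := B x) sB (fun _ _ _ _ _ => I) B0' I I.
rewrite ip_norm => h.
have h2 : p (B (B x)) (B x) <= K * `|B x| ^+ 2.
  apply: le_trans (ler_norm _) (le_trans (ip_cauchy_schwarz _ _ _) _).
  by rewrite expr2 mulrA ler_wpM2r.
have [Bx0|Bx0] := eqVneq (B x) 0.
  by rewrite Bx0 normr0 expr0n/= ip0l mulr0.
have n0 : 0 < `|B x| ^+ 2 by rewrite exprn_gt0// normr_gt0.
rewrite -(ler_pM2r n0) -expr2; apply: le_trans h _.
by rewrite [K * _]mulrC -mulrA ler_wpM2l// B0'.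
Qed.

(** For B >= 0 the values |B x|^2 and (B x, x) are small together; hence a
    bound |B x| >= k |x| passes to the form. *)
Lemma form_ge_improve B : sym B -> bounded_op B -> form_ge B 0 ->
  bounded_below B -> exists2 e, 0 < e & form_ge B e.
Proof.
move=> sB bB B0 [k k0 Bk]; have [K K0 BK] := nonneg_op_norm sB bB B0.
exists (k ^+ 2 / K); first by rewrite divr_gt0// exprn_gt0.
move=> x; rewrite mulrAC ler_pdivrMr// [leRHS]mulrC.
apply: le_trans (BK x); rewrite -exprMn ler_pXn2r// nnegrE ?mulr_ge0// ltW//.
Qed.

(** The infimum of the numerical range is an approximate eigenvalue: the
    largest lower bound q <= m of the form could be increased by
    form_ge_improve if it were smaller than m. *)
Lemma form_ge_continuation B m : sym B -> bounded_op B ->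
  (forall q, q < m -> form_ge B q -> bounded_below (spectral_shift B q)) -> form_ge B m.
Proof.
move=> sB bB h; have [K K0 BK] := bB.
pose A := [set q | q <= m /\ form_ge B q].
have AK : A (Num.min m (- K)).
  split; first by rewrite ge_min lexx.
  move=> x; apply: (@le_trans _ _ (- K * `|x| ^+ 2)).
    by rewrite ler_wpM2r// ge_min lexx orbT.
  have : `|p (B x) x| <= K * `|x| ^+ 2.
    apply: le_trans (ip_cauchy_schwarz _ _ _) _.
    by rewrite expr2 mulrA ler_wpM2r.
  by rewrite mulNr => /ler_normlP[]; lra.
have hA : has_sup A by split; [exists (Num.min m (- K))|exists m => q []].
have sm : sup A <= m by apply: ge_sup; [exact: hA.1|move=> q []].
have gs : form_ge B (sup A).
  move=> x; have [->|x0] := eqVneq x 0.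
    by rewrite normr0 expr0n/= mulr0 ip0r.
  have n0 : 0 < `|x| ^+ 2 by rewrite exprn_gt0// normr_gt0.
  rewrite -ler_pdivlMr//; apply: ge_sup; first exact: hA.1.
  by move=> q [_ Bq]; rewrite ler_pdivlMr.
move: sm; rewrite le_eqVlt => /predU1P[<-//|sm].
have [|e e0] := form_ge_improve (shift_sym (sup A) sB) (shift_bounded (sup A) bB) _ (h _ sm gs).
  by apply/form_ge_shift; rewrite addr0.
move=> /form_ge_shift ge.
have : Num.min m (sup A + e) <= sup A.
  apply: sup_upper_bound => //; split; first by rewrite ge_min lexx.
  move=> x; apply: le_trans (ge x); rewrite ler_wpM2r//.
  by rewrite ge_min lexx orbT.
by rewrite ge_min leNgt sm /= => ?; lra.
Qed.

(** This is (B - a)(B - b) >= 0, the trace that a gap (a, b) of the spectrum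
    leaves in the form. For q < 0 and m, r the midpoint and the half length
    of the interval, (B - a)(B - b) - q is (B - m)^2 - (r^2 + q): a product
    of two shifts of B by points of the gap when r^2 + q >= 0, positive
    definite otherwise. So form_ge_continuation applies to (B - a)(B - b). *)
Lemma gap_form_ge B a b : sym B -> bounded_op B -> a < b ->
  (forall q, a < q -> q < b -> bounded_below (spectral_shift B q)) ->
  forall x, b * p (spectral_shift B a x) x <= p (B x) (spectral_shift B a x).
Proof.
move=> sB bB ab h.
have bBt q : bounded_op (spectral_shift B q) by exact: shift_bounded.
pose Q := spectral_shift B a \o spectral_shift B b.
have sQ : sym Q.
  move=> x y; rewrite /Q /= !(shift_sym _ sB); congr (p x _).
  by apply: (@ip_ext _ _ p) => z; rewrite /spectral_shift ?(ipE, sB); ring.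
have Q0 : form_ge Q 0.
  apply: form_ge_continuation => //; first exact: comp_bounded.
  move=> q q0 _; pose m := (a + b) / 2; pose r := (b - a) / 2.
  have r0 : 0 < r by rewrite divr_gt0// subr_gt0.
  have [rq|rq] := leP 0 (r ^+ 2 + q).
    pose s := Num.sqrt (r ^+ 2 + q).
    have s2 : s ^+ 2 = r ^+ 2 + q by rewrite sqr_sqrtr.
    have s0 : 0 <= s by rewrite sqrtr_ge0.
    have sr : s < r.
      by rewrite -(@ltr_pXn2r _ 2) ?nnegrE// ?ltW// s2; lra.
    have -> : spectral_shift Q q = spectral_shift B (m - s) \o spectral_shift B (m + s).
      apply/funext => x; apply: (@ip_ext _ _ p) => z.
      rewrite /Q/= /spectral_shift ?(ipE, sB).
      have -> : q = s ^+ 2 - r ^+ 2 by rewrite s2; ring.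
      by rewrite /m /r; field.
    by apply: comp_bounded_below; apply: h; rewrite /m; move: sr; rewrite /r; lra.
  apply: (@bounded_belowP _ (- (r ^+ 2 + q))); first by rewrite oppr_gt0.
  move=> x; rewrite -subr_ge0.
  suff -> : p (spectral_shift Q q x) x - - (r ^+ 2 + q) * `|x| ^+ 2 =
    p (spectral_shift B m x) (spectral_shift B m x) by exact: ip_ge0.
  rewrite /Q/= /spectral_shift !ipE -!(ip_norm p) ?(ipE, sB).
  by rewrite /m /r; field.
move=> x; have := Q0 x; rewrite mul0r /Q/= -subr_ge0; congr (_ <= _).
by rewrite /spectral_shift !ipE ?(ipE, sB); ring.
Qed.

End Spectral.

(** * Orthogonal decomposition in a Hilbert space *)

Section Projection.
Variables (R : realType) (X : completeNormedModType R) (p : inner_product X).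
Implicit Types (x y : X) (M Y : set X).

Lemma parallelogram x y :
  `|x - y| ^+ 2 = `|x| ^+ 2 *+ 2 + `|y| ^+ 2 *+ 2 - `|x + y| ^+ 2.
Proof. by rewrite -!(ip_norm p) !ipE; ring. Qed.

Definition subspace M := M 0 /\ forall (a : R) x y, M x -> M y -> M (a *: x + y).

(** The vector z is the limit of x - m n along a minimizing sequence of the
    distance from x to M, a Cauchy sequence by the parallelogram identity.
    As M may fail to be closed, x - z is only approximated by elements of M. *)
Lemma orthogonal_decomposition M x : subspace M -> exists z : X,
  (forall m, M m -> p z m = 0) /\
  forall e : R, 0 < e -> exists2 m, M m & `|x - z - m| < e.
Proof.
move=> [M0 Mlin].
have MZ (a : R) m : M m -> M (a *: m).
  by move=> Mm; have := Mlin a _ _ Mm M0; rewrite addr0.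
have MD m m' : M m -> M m' -> M (m + m').
  by move=> Mm Mm'; have := Mlin 1 _ _ Mm Mm'; rewrite scale1r.
pose D := [set `|x - m| ^+ 2 | m in M]; pose d := inf D.
have hD : has_inf D.
  split; first by exists (`|x - 0| ^+ 2), 0.
  by exists 0 => _ [m _ <-]; exact: sqr_ge0.
have dD m : M m -> d <= `|x - m| ^+ 2.
  by move=> Mm; apply: ge_inf; [exact: hD.2|exists m].
(* A minimizing sequence, with a rate that makes it Cauchy. *)
have near_d n : exists m, M m /\ `|x - m| ^+ 2 < d + n.+1%:R^-1.
  have e0 : 0 < n.+1%:R^-1 :> R by rewrite invr_gt0 ltr0n.
  by have [_ [m Mm <-] xm] := inf_adherent e0 hD; exists m.
have [m hm] := choice near_d; pose u n := x - m n.
have uk n k : (n <= k)%N -> `|u n - u k| ^+ 2 <= 4 * n.+1%:R^-1.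
  move=> nk; rewrite parallelogram.
  have := dD (2^-1 *: (m n + m k)) (MZ _ _ (MD _ _ (hm n).1 (hm k).1)).
  have -> : x - 2^-1 *: (m n + m k) = 2^-1 *: (u n + u k).
    have {1}-> : x = 2^-1 *: (x + x).
      by rewrite -[x + x]mulr2n -[x *+ 2]scaler_nat scalerA mulVf ?scale1r ?pnatr_eq0.
    by rewrite -scalerBr /u opprD addrACA.
  rewrite normrZ exprMn ger0_norm//.
  have -> : 2^-1 ^+ 2 = 4^-1 :> R by field.
  move=> h.
  have [_ hn] := hm n; have [_ hk] := hm k.
  have nk' : k.+1%:R^-1 <= n.+1%:R^-1 :> R by rewrite lef_pV2 ?posrE ?ltr0n// ler_nat.
  rewrite -/(u n) -/(u k) in hn hk; rewrite -/(u n) -/(u k).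
  move: hn hk nk' h; move: (n.+1%:R^-1) (k.+1%:R^-1) => r s.
  by rewrite !mulr2n; lra.
have cu : cvg (u @ \oo).
  apply: cauchy_cvg; apply: cauchy_exP => e e0.
  have [N _ hN] := near_infty_natSinv_lt (PosNum (divr_gt0 (exprn_gt0 2 e0) (ltr0Sn R 3))).
  exists (u N); exists N => // n /= Nn; rewrite -ball_normE /=.
  apply: lt_of_sqr_lt (ltW e0) _; apply: le_lt_trans (uk _ _ Nn) _.
  by rewrite mulrC -ltr_pdivlMr//; apply: (hN N) => /=.
pose z := lim (u @ \oo); exists z.
have ulim (e : R) : 0 < e -> exists n, `|z - u n| < e /\ n.+1%:R^-1 < e ^+ 2.
  move=> e0; have /cvgrPdist_lt/(_ _ e0) := cu => h.
  have [N _ hN] : \forall n \near \oo, `|z - u n| < e /\ n.+1%:R^-1 < e ^+ 2.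
    near=> n; split; first by near: n.
    by near: n; exact: (near_infty_natSinv_lt (PosNum (exprn_gt0 2 e0))).
  by exists N; apply: hN => /=.
split; last first.
  move=> e /ulim[n [zn _]]; exists (m n); first exact: (hm n).1.
  by rewrite addrAC distrC -/(u n).
have d0 : 0 <= d.
  by apply: lb_le_inf; [exact: hD.1|move=> _ [? _ <-]; exact: sqr_ge0].
have d_sqr : Num.sqrt d ^+ 2 = d by rewrite sqr_sqrtr.
have s0 : 0 <= Num.sqrt d by exact: sqrtr_ge0.
have xz_d y : M y -> Num.sqrt d <= `|z - y|.
  move=> My; apply/ler_addgt0Pr => e' e'0; have [n [zn _]] := ulim _ e'0.
  apply: (@le_trans _ _ `|u n - y|).
    apply: le_of_sqr_le => //; rewrite d_sqr.
    rewrite /u -addrA -opprD; apply: dD; apply: MD => //; exact: (hm n).1.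
  have -> : u n - y = (z - y) - (z - u n) by rewrite opprB [RHS]addrC addrA subrK.
  by apply: le_trans (ler_normB _ _) _; rewrite lerD2l ltW.
have zd : `|z| <= Num.sqrt d.
  apply/ler_addgt0Pr => e e0; have e20 : 0 < e / 2 by rewrite divr_gt0.
  have [n [zn nk]] := ulim _ e20; have [_ hn] := hm n; rewrite -/(u n) in hn.
  have un : `|u n| < Num.sqrt d + e / 2.
    apply: lt_of_sqr_lt; first by lra.
    apply: lt_le_trans hn _; rewrite -[in leLHS]d_sqr.
    by move: nk (mulr_ge0 s0 (ltW e20)); move: (n.+1%:R^-1) => r; rewrite sqrrD mulr2n; lra.
  have {1}-> : z = u n + (z - u n) by rewrite addrC subrK.
  by apply: le_trans (ler_normD _ _) _; lra.
move=> y My; apply/eqP; rewrite -sqrf_eq0 eq_le sqr_ge0 andbT.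
apply: le_trans (@discr_le _ 0 (p z y) (`|y| ^+ 2) _ _ _) _ => //.
  move=> t; have := xz_d _ (MZ (- t) _ My); rewrite scaleNr opprK.
  move=> h; have : `|z| ^+ 2 <= `|z + t *: y| ^+ 2.
    by rewrite ler_pXn2r ?nnegrE// (le_trans zd).
  by rewrite -!(ip_norm p) !ipE (ip_sym p y) mulr2n; lra.
Unshelve. all: by end_near.
Qed.

End Projection.

(** * Crossing a spectral gap *)

Section Coercivity.
Variables (R : realType) (X : completeNormedModType R) (p : inner_product X).
Variable A : blin X X.
Hypothesis sA : symmetric_op p A.
Implicit Types (x y z : X) (Y : set X).

Lemma closed_approx Y y : closed Y ->
  (forall e : R, 0 < e -> exists2 w, Y w & `|y - w| < e) -> Y y.
Proof.
move=> cY h; apply: cY => B /nbhs_ballP[e /= e0 yB].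
have [w Yw yw] := h _ e0; exists w; split => //; apply: yB.
by rewrite -ball_normE.
Qed.

Lemma quadratic_form_continuous : continuous (fun x => p (A x) x).
Proof.
move=> x; rewrite (_ : (fun x => _) =
    fun x => 4^-1 * (`|A x + x| ^+ 2 - `|A x - x| ^+ 2)); last first.
  by apply/funext => z; exact: ip_polar.
have sq (f : X -> X) : f y @[y --> x] --> f x ->
    `|f y| ^+ 2 @[y --> x] --> `|f x| ^+ 2.
  by rewrite expr2 => fz; apply: cvgM; exact: cvg_norm.
have cA : A y @[y --> x] --> A x by exact: blin_continuous.
apply: cvgMl_tmp; apply: cvgB.
  by apply: (sq (fun y => A y + y)); apply: cvgD => //; exact: cvg_id.
by apply: (sq (fun y => A y - y)); apply: cvgB => //; exact: cvg_id.
Qed.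

(** Put C = A - a, which is nonnegative on Y. The gap gives (b - a)(C v, v)
    <= |C v|^2, and the Cauchy-Schwarz inequality of the form of C gives |C
    v|^4 <= (C v, v)(C C v, C v); together they bound the form of A by b
    from below on the range of C. This range is dense in Y, because a vector
    of Y orthogonal to it lies in the kernel of C, which meets Y trivially. *)
Lemma form_ge_on_raise Y a b : a < b -> subspace Y -> closed Y ->
  (forall y, Y y -> Y (A y)) ->
  (forall y, Y y -> a * `|y| ^+ 2 <= p (A y) y) ->
  (forall q, a < q -> q < b -> bounded_below (spectral_shift A q)) ->
  (forall y, Y y -> A y = a *: y -> y = 0) ->
  forall y, Y y -> b * `|y| ^+ 2 <= p (A y) y.
Proof.
move=> ab sY cY AY aY gap kerY; have [Y0 Ylin] := sY.
pose C := spectral_shift A a.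
have sC : symmetric_op p C by exact: shift_sym.
have CY y : Y y -> Y (C y).
  by move=> Yy; rewrite /C /spectral_shift -scaleNr addrC; apply: Ylin => //; exact: AY.
have C0 y : Y y -> 0 <= p (C y) y.
  by move=> Yy; rewrite /C /spectral_shift !ipE ip_norm subr_ge0 aY.
have range_ge v : Y v -> b * `|C v| ^+ 2 <= p (A (C v)) (C v).
  move=> Yv; have [w Cv] : exists w, C v = w by exists (C v).
  have Yw : Y w by rewrite -Cv; exact: CY.
  rewrite Cv.
  have h1 : (b - a) * p w v <= `|w| ^+ 2.
    have := gap_form_ge sA (blin_bounded A) ab gap v; rewrite -/(C v) Cv.
    have -> : A v = w + a *: v by rewrite -Cv /C /spectral_shift subrK.
    by rewrite !ipE (ip_sym p v) ip_norm; lra.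
  have h2 := form_cauchy_schwarz sC Ylin C0 Yv Yw.
  rewrite Cv ip_norm in h2.
  have h3 : p (A w) w = p (C w) w + a * `|w| ^+ 2.
    by rewrite /C /spectral_shift !ipE ip_norm; ring.
  have [w0|w0] := eqVneq w 0.
    by rewrite w0 normr0 expr0n/= mulr0 ip0r.
  have n0 : 0 < `|w| ^+ 2 by rewrite exprn_gt0// normr_gt0.
  have h4 : 0 <= p (C w) w by exact: C0.
  have h5 : (b - a) * `|w| ^+ 2 <= p (C w) w.
    rewrite -(ler_pM2l n0); apply: (@le_trans _ _ ((b - a) * (p w v * p (C w) w))).
      have ba : 0 < b - a by rewrite subr_gt0.
      have -> : `|w| ^+ 2 * ((b - a) * `|w| ^+ 2) =
        (b - a) * ((`|w| ^+ 2) ^+ 2) by ring.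
      by rewrite ler_pM2l.
    by rewrite mulrA ler_wpM2r.
  by rewrite h3; lra.
have sM : subspace (C @` Y).
  split; first by exists 0 => //; rewrite /C /spectral_shift linear0 scaler0 subr0.
  move=> t _ _ [u Yu <-] [v Yv <-]; exists (t *: u + v); first exact: Ylin.
  exact: symmetric_opDZ sC.
move=> y Yy; have [z [zM yz]] := orthogonal_decomposition p y sM.
have Yyz : Y (y - z).
  apply: closed_approx => // e /yz[_ [v Yv <-] h].
  by exists (C v) => //; exact: CY.
have Yz : Y z.
  have -> : z = (-1) *: (y - z) + y by rewrite scaleN1r opprB subrK.
  exact: Ylin.
have z0 : z = 0.
  apply: kerY => //; apply/eqP; rewrite -subr_eq0 -/(spectral_shift A a z) -/(C z).
  rewrite -normr_eq0 -sqrf_eq0 -(ip_norm p) sC zM//.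
  by exists (C z) => //; exact: CY.
pose F := [set w | 0 <= p (A w) w - b * `|w| ^+ 2].
have cF : closed F.
  have -> : F = (fun w => p (A w) w - b * `|w| ^+ 2) @^-1` [set r | 0 <= r] by [].
  apply: preimage_closed; last exact: closed_ge.
  move=> w _; apply: cvgB; first exact: quadratic_form_continuous.
  by apply: cvgMl_tmp; rewrite expr2; apply: cvgM; exact: norm_continuous.
suff : F y by rewrite /F/= subr_ge0.
apply: closed_approx => // e /yz[_ [v Yv <-]]; rewrite z0 subr0 => h.
by exists (C v) => //; rewrite /F/= subr_ge0; exact: range_ge.
Qed.

Lemma bounded_below_notin_spectrum q :
  ~ spectrum A q -> bounded_below (spectral_shift A q).
Proof.
rewrite /spectrum/= => /contrapT[S [AS _]].
have [M M0 SM] := blin_bounded S.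
exists M^-1; first by rewrite invr_gt0.
move=> x; rewrite mulrC ler_pdivrMr// mulrC.
by rewrite -[x in leLHS]AS; exact: SM.
Qed.

End Coercivity.

(** * Coercivity modulo one negative direction and the kernel *)

(** The scalar inequality behind constrained_coercivity. There - s al^2 and
    n are the negative and the positive part of the form at v, m is the
    mixed term of the positive parts of y and v, and N < s a^2 expresses
    that the form is negative at y. Then s al^2 is at most a fraction of n,
    up to the square of m - s a al, which is the value of the form at y and
    v. *)
Lemma one_negative_direction (R : realType) (s a N : R) : 0 < s -> 0 <= N ->
  N < s * a ^+ 2 ->
  exists k K : R, [/\ 0 < k, 0 < K & forall al m n : R, 0 <= n ->
    m ^+ 2 <= N * n ->
    k * (al ^+ 2 + n) <= n - s * al ^+ 2 + K * (m - s * a * al) ^+ 2].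
Proof.
move=> s0 N0; set M := s * a ^+ 2 => NM; have M0 : 0 < M by exact: le_lt_trans NM.
(* This choice gives (1 + e) N <= (1 - e) M. *)
pose e := (M - N) / (2 * M); have e0 : 0 < e.
  by apply: divr_gt0; [rewrite subr_gt0|rewrite mulr_gt0].
have eM : e * (2 * M) = M - N by rewrite divfK// gt_eqF// mulr_gt0.
pose K0 := (1 + e^-1) / M; have K00 : 0 < K0.
  by rewrite divr_gt0// addr_gt0// invr_gt0.
pose k := e / (1 + s^-1); have k0 : 0 < k.
  by rewrite divr_gt0// addr_gt0// invr_gt0.
exists k, (K0 + k * K0 / s); split=> //.
  by rewrite addr_gt0// divr_gt0// mulr_gt0.
move=> al m n n0 mN; set g := m - _.
have h1 : s * al ^+ 2 <= (1 - e) * n + K0 * g ^+ 2.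
  rewrite -(ler_pM2l M0).
  have -> : M * (s * al ^+ 2) = (m - g) ^+ 2 by rewrite /g /M; ring.
  have -> : M * ((1 - e) * n + K0 * g ^+ 2) =
      (M - e * M) * n + (1 + e^-1) * g ^+ 2.
    by rewrite /K0; field; rewrite !gt_eqF.
  have h2 : (m - g) ^+ 2 <= (1 + e) * m ^+ 2 + (1 + e^-1) * g ^+ 2.
    rewrite -subr_ge0.
    have -> : (1 + e) * m ^+ 2 + (1 + e^-1) * g ^+ 2 - (m - g) ^+ 2 =
      (e * m + g) ^+ 2 / e by field; rewrite gt_eqF.
    by rewrite divr_ge0 ?sqr_ge0// ltW.
  apply: le_trans h2 _; rewrite lerD2r.
  apply: (@le_trans _ _ ((1 + e) * (N * n))).
    by rewrite ler_wpM2l// addr_ge0// ltW.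
  rewrite mulrA ler_wpM2r//.
  have : e * N <= e * M by rewrite ler_wpM2l// ltW.
  by lra.
have h3 : k * al ^+ 2 <= k / s * (n + K0 * g ^+ 2).
  rewrite -mulrA ler_pM2l// mulrC ler_pdivlMr// mulrC.
  apply: le_trans h1 _; rewrite lerD2r.
  by have := mulr_ge0 (ltW e0) n0; lra.
have ke : k + k / s = e.
  by rewrite /k; field; rewrite !gt_eqF// addr_gt0.
have h4 : k * n + k / s * n = e * n by rewrite -mulrDl ke.
have h5 : k / s * (K0 * g ^+ 2) = k * K0 / s * g ^+ 2 by ring.
by rewrite !mulrDr mulrDl in h3 *; lra.
Qed.

Section ConstrainedCoercivity.
Variables (R : realType) (X : completeNormedModType R) (p : inner_product X).
Variables (A : blin X X) (mu delta : R) (chi tau : X) (Sigma : set R).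
Hypotheses (sA : forall x y, p (A x) y = p x (A y))
  (specA : spectrum A = [set - mu ^+ 2] `|` [set 0] `|` Sigma)
  (mu0 : - mu ^+ 2 < 0) (chi1 : `|chi| = 1)
  (chi_eig : simple_eigenvalue A (- mu ^+ 2) chi)
  (tau_eig : simple_eigenvalue A 0 tau)
  (delta0 : 0 < delta) (Sigma_delta : forall l, Sigma l -> delta <= l).

Let notin_spec q : q != - mu ^+ 2 -> q != 0 -> q < delta -> ~ spectrum A q.
Proof.
move=> q1 q2 qd; rewrite specA => -[[/eqP|/eqP]|/Sigma_delta].
- by rewrite (negbTE q1).
- by rewrite (negbTE q2).
- by rewrite leNgt qd.
Qed.

Let Achi : A chi = - mu ^+ 2 *: chi.
Proof.
have [_ /seteqP[_ h]] := chi_eig; apply: (h chi).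
by exists 1 => //; rewrite scale1r.
Qed.

Let Atau : A tau = 0.
Proof.
have [_ /seteqP[_ h]] := tau_eig; rewrite -(scale0r tau); apply: (h tau).
by exists 1 => //; rewrite scale1r.
Qed.

Let chi_tau : p chi tau = 0.
Proof.
have := sA chi tau; rewrite Achi Atau ip0r ipZl => /eqP.
by rewrite mulf_eq0 (lt_eqF mu0)/= => /eqP.
Qed.

Let closed_orth (e : X) : closed [set x | p e x = 0].
Proof.
have -> : [set x | p e x = 0] = p e @^-1` [set 0] by [].
by apply: preimage_closed; [move=> x _; exact: ip_continuous|exact: closed_eq].
Qed.

(** Away from chi the lower bound of the form passes from - mu^2 across the
    gap (- mu^2, 0). *)
Lemma form_ge_orth_negative y : p chi y = 0 -> 0 <= p (A y) y.
Proof.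
move=> cy; rewrite -(mul0r (`|y| ^+ 2)).
apply: (@form_ge_on_raise R X p A sA [set y | p chi y = 0] (- mu ^+ 2) 0) => //.
- split=> [|a x z /= cx cz]; first exact: ip0r.
  by rewrite !ipE cx cz mulr0 addr0.
- by move=> x /= cx; rewrite -sA Achi ipZl cx mulr0.
- move=> x _; apply: (form_ge_continuation (m := - mu ^+ 2)) => //.
  + exact: blin_bounded.
  + move=> q q1 _; apply: bounded_below_notin_spectrum; apply: notin_spec.
    * by rewrite lt_eqF.
    * by rewrite lt_eqF// (lt_trans q1).
    * by rewrite (lt_trans q1)// (lt_trans mu0).
- move=> q q1 q2; apply: bounded_below_notin_spectrum; apply: notin_spec.
  + by rewrite gt_eqF.
  + by rewrite lt_eqF.
  + by rewrite (lt_trans q2).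
- move=> x /= cx Ax; have [_ /seteqP[h _]] := chi_eig.
  have [a _ ax] := h _ Ax; move: cx.
  by rewrite -ax ipZr ip_norm chi1 expr1n mulr1 => ->; rewrite scale0r.
Qed.

(** Away from chi and tau the lower bound passes from 0 across the gap (0,
    delta). *)
Lemma form_ge_orth_both y : p chi y = 0 -> p tau y = 0 ->
  delta * `|y| ^+ 2 <= p (A y) y.
Proof.
move=> cy ty.
apply: (@form_ge_on_raise R X p A sA
  ([set y | p chi y = 0] `&` [set y | p tau y = 0]) 0 delta) => //.
- split=> [|a x z /= [cx tx] [cz tz]]; first by split; exact: ip0r.
  by split; rewrite /= !ipE ?(cx, cz, tx, tz) mulr0 addr0.
- exact: closedI.
- move=> x /= [cx tx]; rewrite -!sA Achi Atau ipZl cx mulr0.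
  by split=> //; rewrite ip0l.
- by move=> x [cx _]; rewrite mul0r; exact: form_ge_orth_negative.
- move=> q q1 q2; apply: bounded_below_notin_spectrum; apply: notin_spec => //.
  + by rewrite gt_eqF// (lt_trans mu0).
  + by rewrite gt_eqF.
- move=> x /= [_ tx] Ax; have [tau0 /seteqP[h _]] := tau_eig.
  have [a _ ax] := h _ Ax; move: tx.
  rewrite -ax ipZr => /eqP; rewrite mulf_eq0 ip_norm sqrf_eq0 normr_eq0.
  by rewrite (negbTE tau0) orbF => /eqP ->; rewrite scale0r.
Qed.

Let split_orth v : exists al b v', [/\ v = al *: chi + b *: tau + v',
  p chi v' = 0, p tau v' = 0 & b * `|tau| ^+ 2 = p tau v].
Proof.
have [tau0 _] := tau_eig.
have nt : p tau tau != 0 by rewrite ip_norm sqrf_eq0 normr_eq0.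
exists (p chi v), (p tau v / p tau tau).
exists (v - (p chi v *: chi + p tau v / p tau tau *: tau)); split.
- by rewrite addrC subrK.
- by rewrite !ipE chi_tau ip_norm chi1; ring.
- by rewrite !ipE (ip_sym p tau chi) chi_tau; field.
- by rewrite -(ip_norm p) divfK.
Qed.

(** Along chi, tau and their orthogonal complement the form is - mu^2, 0 and
    at least delta. A vector y where the form is negative has a chi
    component that outweighs the rest, so that (A y, v) controls the chi
    component of v. *)
Lemma constrained_coercivity y : p (A y) y < 0 ->
  exists k K : R, [/\ 0 < k, 0 < K & forall v, k * `|v| ^+ 2 <=
    p (A v) v + K * (p (A y) v ^+ 2 + p tau v ^+ 2)].
Proof.
have [a [c [y' [-> cy' ty' _]]]] := split_orth y.
have tau0 : 0 < `|tau| ^+ 2.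
  by rewrite exprn_gt0// normr_gt0; case: tau_eig.
set y0 := _ + y'.
have AE r s w : A (r *: chi + s *: tau + w) = r *: (- mu ^+ 2 *: chi) + A w.
  by rewrite -addrA (@blin_linear R X X A) (@blin_linear R X X A) Achi Atau scaler0 add0r.
have form al b v' : p chi v' = 0 -> p tau v' = 0 ->
    p (A y0) (al *: chi + b *: tau + v') = - mu ^+ 2 * a * al + p (A y') v'.
  move=> cv tv; rewrite /y0 AE.
  have yc : p (A y') chi = 0 by rewrite sA Achi ipZr ip_sym cy' mulr0.
  have yt : p (A y') tau = 0 by rewrite sA Atau ip0r.
  by rewrite !ipE yc yt chi_tau cv (ip_norm p chi) chi1; ring.
have form2 al b v' : p chi v' = 0 -> p tau v' = 0 ->
    p (A (al *: chi + b *: tau + v')) (al *: chi + b *: tau + v') =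
    - mu ^+ 2 * al ^+ 2 + p (A v') v'.
  move=> cv tv; rewrite AE.
  have yc : p (A v') chi = 0 by rewrite sA Achi ipZr ip_sym cv mulr0.
  have yt : p (A v') tau = 0 by rewrite sA Atau ip0r.
  by rewrite !ipE yc yt chi_tau cv (ip_norm p chi) chi1; ring.
rewrite /y0 form2// -/y0 => yneg.
have mu20 : 0 < mu ^+ 2 by rewrite -oppr_lt0.
have N0 : 0 <= p (A y') y' by exact: form_ge_orth_negative.
have NM : p (A y') y' < mu ^+ 2 * a ^+ 2 by move: yneg; lra.
have [k [K [k0 K0 kK]]] := one_negative_direction mu20 N0 NM.
pose k' := k * Num.min 1 delta.
have k'0 : 0 < k' by rewrite mulr_gt0// lt_min ltr01.
exists k', (K + k' / `|tau| ^+ 2); split => //.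
  by rewrite addr_gt0// divr_gt0.
move=> v; have [al [b [v' [Ev cv tv btau]]]] := split_orth v.
have n0 : 0 <= p (A v') v' by exact: form_ge_orth_negative.
have CS : p (A y') v' ^+ 2 <= p (A y') y' * p (A v') v'.
  apply: (@form_cauchy_schwarz _ _ p A [set x | p chi x = 0]) => //=.
  - by move=> t x z cx cz; rewrite !ipE cx cz mulr0 addr0.
  - exact: form_ge_orth_negative.
have := kK al (p (A y') v') (p (A v') v') n0 CS.
have -> : p (A y') v' - mu ^+ 2 * a * al = p (A y0) v by rewrite Ev form//; ring.
have -> : p (A v') v' - mu ^+ 2 * al ^+ 2 = p (A v) v.
  by rewrite Ev form2//; ring.
have -> : `|v| ^+ 2 = al ^+ 2 + `|v'| ^+ 2 + p tau v ^+ 2 / `|tau| ^+ 2.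
  rewrite -(ip_norm p v) -btau Ev !ipE chi_tau cv tv !ip_norm chi1.
  rewrite (ip_sym p tau chi) chi_tau (ip_sym p v') cv (ip_sym p v') tv.
  by field; rewrite gt_eqF// normr_gt0; case: tau_eig.
have h1 : k' * al ^+ 2 <= k * al ^+ 2.
  by rewrite ler_wpM2r ?sqr_ge0// /k' ler_piMr ?(ltW k0)// ge_min lexx.
have h2 : k' * `|v'| ^+ 2 <= k * p (A v') v'.
  rewrite /k' -mulrA ler_pM2l//.
  apply: le_trans (form_ge_orth_both cv tv); rewrite ler_wpM2r ?sqr_ge0//.
  by rewrite ge_min lexx orbT.
have h3 : 0 <= k' / `|tau| ^+ 2 * p (A y0) v ^+ 2.
  by rewrite mulr_ge0 ?sqr_ge0// divr_ge0// ltW.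
have h4 : 0 <= K * p tau v ^+ 2 by rewrite mulr_ge0 ?sqr_ge0// ltW.
have -> : k' * (al ^+ 2 + `|v'| ^+ 2 + p tau v ^+ 2 / `|tau| ^+ 2) =
  k' * al ^+ 2 + k' * `|v'| ^+ 2 + k' / `|tau| ^+ 2 * p tau v ^+ 2 by ring.
by rewrite !mulrDr !mulrDl; lra.
Qed.

End ConstrainedCoercivity.

(** * Distributional derivatives that are classical *)

Lemma is_derive_mul (R : realType) (f g : R -> R) (x df dg : R) :
  is_derive x 1 f df -> is_derive x 1 g dg ->
  is_derive x 1 (fun y => f y * g y) (df * g x + f x * dg).
Proof.
move=> hf hg; have h := @is_deriveM R R f g x 1 df dg hf hg.
by apply: (is_derive_eq h); rewrite /GRing.scale/=; ring.
Qed.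

Lemma is_derive_cvgP (R : realType) (V : normedModType R) (f : R -> V) (x : R) (l : V) :
  is_derive x 1 f l <-> h^-1 *: (f (h + x) - f x) @[h --> (0 : R)^'] --> l.
Proof.
have E : (fun h : R => h^-1 *: (f (h + x) - f x)) =
    (fun h => h^-1 *: ((f \o shift x) (h *: 1) - f x)).
  by apply/funext => h /=; rewrite /GRing.scale/= mulr1.
rewrite E; split=> [[+ <-]|h]; first by [].
by apply: DeriveDef; [apply/cvg_ex; exists l|exact: cvg_lim].
Qed.

Section Bump.
Variable R : realType.
Implicit Types (x t e : R) (f g : R -> R).

(** The powers of 1/x make this family of functions stable under
    differentiation up to linear combinations. *)
Definition flat (n : nat) x : R :=
  if 0 < x then x^-1 ^+ n * expR (- x^-1) else 0.

Lemma flat_ge0 n x : 0 <= flat n x.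
Proof.
by rewrite /flat; case: ifPn => // x0; rewrite mulr_ge0 ?expR_ge0// exprn_ge0// invr_ge0 ltW.
Qed.

Lemma flat_gt0 n x : 0 < x -> 0 < flat n x.
Proof. by move=> x0; rewrite /flat x0 mulr_gt0 ?expR_gt0// exprn_gt0// invr_gt0. Qed.

Lemma flat_le0 n x : x <= 0 -> flat n x = 0.
Proof. by rewrite /flat leNgt => /negbTE ->. Qed.

Lemma flatS n x : flat n x = x * flat n.+1 x.
Proof.
rewrite /flat; case: ifPn => x0; last by rewrite mulr0.
by rewrite exprS mulrA mulrA divff ?mul1r// gt_eqF.
Qed.

Lemma flat_le n x : flat n x <= n.+1`!%:R * `|x|.
Proof.
have [x0|x0] := leP x 0; first by rewrite flat_le0// mulr_ge0.
rewrite flatS gtr0_norm// mulrC ler_pM2r// /flat x0 expRN.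
rewrite ler_pdivrMr ?expR_gt0//.
have := @expR_ge1Dxn R x^-1 n; rewrite invr_ge0 (ltW x0) => /(_ isT) h.
by rewrite mulrC -ler_pdivrMr ?ltr0n ?fact_gt0//; lra.
Qed.

Lemma flat_is_derive n x :
  is_derive x 1 (flat n) (flat n.+2 x - n%:R * flat n.+1 x).
Proof.
have [x0|x0|x0] := ltgtP x 0.
- rewrite !flat_le0 ?ltW// mulr0 subrr.
  apply: (@near_eq_is_derive _ _ _ (cst 0)).
  by near=> y; rewrite flat_le0//; near: y; apply: filterS (lt_nbhsl x0) => y /ltW.
- have xn0 : x != 0 by rewrite gt_eqF.
  have dV : is_derive x 1 (fun y : R => y^-1) (- (x^-1 ^+ 2)).
    apply: is_derive_eq; first by apply: is_deriveV.
    by rewrite /= -exprVn; rewrite /GRing.scale/= mulr1.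
  have dN : is_derive x 1 (fun y : R => - y^-1) (x^-1 ^+ 2).
    by apply: is_derive_eq; rewrite opprK.
  have dE : is_derive x 1 (fun y : R => expR (- y^-1)) (expR (- x^-1) * x^-1 ^+ 2).
    exact: (@is_derive1_comp R expR (fun y : R => - y^-1)).
  have dX : is_derive x 1 (fun y : R => y^-1 ^+ n) (n%:R * x^-1 ^+ n.-1 * - (x^-1 ^+ 2)).
    apply: (@is_derive1_comp R (@GRing.exp R ^~ n) (fun y : R => y^-1)) => //.
    apply: DeriveDef; first exact: exprn_derivable.
    by rewrite exp_derive /GRing.scale/= mulr1.
  apply: (@near_eq_is_derive R R R (fun y : R => y^-1 ^+ n * expR (- y^-1))).
    near=> y; rewrite /flat ifT//; near: y.
    exact: lt_nbhsr.
  apply: (is_derive_eq (is_derive_mul dX dE)).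
  rewrite /flat x0; case: (n) => [|k].
    by rewrite !mul0r subr0 expr0 mul1r add0r mulrC.
  by rewrite !exprS/=; ring.
(* The difference quotient of flat n at 0 is flat n.+1 h, which is O(h). *)
- rewrite x0 !flat_le0// mulr0 subrr.
  pose C := n.+2`!%:R : R.
  have C0 : 0 < C by rewrite ltr0n fact_gt0.
  apply/is_derive_cvgP; apply/cvgrPdist_lt => e e0; near=> h.
  have h0 : h != 0 by near: h; exact: nbhs_dnbhs_neq.
  rewrite addr0 sub0r normrN (flat_le0 _ (lexx 0)) subr0 flatS scalerA mulVf// scale1r.
  rewrite ger0_norm ?flat_ge0//; apply: le_lt_trans (flat_le _ _) _.
  rewrite mulrC -ltr_pdivlMr//.
  by near: h; apply: dnbhs0_lt; exact: divr_gt0.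
Unshelve. all: by end_near.
Qed.

(** A class that contains the bump functions and the derivatives of its
    members; its members are therefore infinitely differentiable. *)
Inductive smooth_alg : (R -> R) -> Prop :=
| smooth_flat n a b : smooth_alg (fun t => flat n (a * t + b))
| smooth_cst k : smooth_alg (fun=> k)
| smooth_add f g : smooth_alg f -> smooth_alg g -> smooth_alg (fun t => f t + g t)
| smooth_mul f g : smooth_alg f -> smooth_alg g -> smooth_alg (fun t => f t * g t).

Lemma flat_affine_derive n a b t : is_derive t 1 (fun t => flat n (a * t + b))
  ((flat n.+2 (a * t + b) - n%:R * flat n.+1 (a * t + b)) * a).
Proof.
apply: (@is_derive1_comp R (flat n) (fun t => a * t + b) t _ _ (flat_is_derive n _)).
have h := is_derive_mul (@is_derive_cst R R R a t 1) (@is_derive_id R R t 1).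
have h2 := @is_deriveD R R R _ _ t 1 _ _ h (@is_derive_cst R R R b t 1).
by apply: (is_derive_eq h2); rewrite /cst/= mul0r mulr1 add0r addr0.
Qed.

Lemma smooth_alg_derive f : smooth_alg f ->
  exists2 f', smooth_alg f' & forall t, is_derive t 1 f (f' t).
Proof.
elim=> [n a b|k|{}f g _ [f' sf ff'] _ [g' sg gg']|
        {}f g sf0 [f' sf ff'] sg0 [g' sg gg']].
- exists (fun t => (flat n.+2 (a * t + b) + - n%:R * flat n.+1 (a * t + b)) * a).
    apply: smooth_mul; last exact: smooth_cst.
    by apply: smooth_add; [exact: smooth_flat|apply: smooth_mul;
      [exact: smooth_cst|exact: smooth_flat]].
  by move=> t; have := flat_affine_derive n a b t; rewrite mulNr.
- by exists (fun=> 0); [exact: smooth_cst|move=> t; exact: is_derive_cst].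
- exists (fun t => f' t + g' t); first exact: smooth_add.
  by move=> t; exact: (@is_deriveD R R R f g).
- exists (fun t => f' t * g t + f t * g' t).
    by apply: smooth_add; exact: smooth_mul.
  by move=> t; exact: is_derive_mul.
Qed.

Lemma smooth_alg_derive1n f k : smooth_alg f -> smooth_alg (derive1n k f).
Proof.
move=> sf; elim: k => [//|k /smooth_alg_derive[f' sf' ff']].
rewrite derive1nS (_ : derive1 _ = f')//; apply/funext => t.
by rewrite derive1E; have [_ ->] := ff' t.
Qed.

(** The arguments are written so as to match smooth_flat. *)
Definition bump (a b : R) : R -> R := fun t => flat 0 (1 * t + - a) * flat 0 (-1 * t + b).

Lemma bump_gt0 a b t : a < t < b -> 0 < bump a b t.
Proof.
by move=> /andP[ta tb]; rewrite mulr_gt0// flat_gt0//; lra.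
Qed.

Lemma bump_out a b t : t <= a \/ b <= t -> bump a b t = 0.
Proof.
move=> h; rewrite /bump; case: h => h.
  by rewrite (@flat_le0 _ (1 * t + - a)) ?mul0r//; lra.
by rewrite (@flat_le0 _ (- 1 * t + b)) ?mulr0//; lra.
Qed.

Lemma smooth_alg_bump a b : smooth_alg (bump a b).
Proof. by apply: smooth_mul; exact: smooth_flat. Qed.

Definition dbump a b t : R :=
  flat 2 (1 * t + - a) * flat 0 (-1 * t + b) -
  flat 0 (1 * t + - a) * flat 2 (-1 * t + b).

Lemma bump_is_derive a b t : is_derive t 1 (bump a b) (dbump a b t).
Proof.
have h := is_derive_mul (flat_affine_derive 0 1 (- a) t) (flat_affine_derive 0 (-1) b t).
by apply: (is_derive_eq h); rewrite /dbump; ring.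
Qed.

Lemma dbump_out a b t : t <= a \/ b <= t -> dbump a b t = 0.
Proof.
move=> h; rewrite /dbump; case: h => h.
  by rewrite !(@flat_le0 _ (1 * t + - a)) ?mul0r ?subr0//; lra.
by rewrite !(@flat_le0 _ (- 1 * t + b)) ?mulr0 ?subr0//; lra.
Qed.

Lemma bump_test_function a b : test_function setT (bump a b).
Proof.
split=> [k t|].
  have [f' _ /(_ t)[]//] := smooth_alg_derive (smooth_alg_derive1n k (smooth_alg_bump a b)).
exists `[a, b]%classic; split=> //; first exact: segment_compact.
move=> t; rewrite /= in_itv/= => /negP; rewrite negb_and -!ltNge => /orP[] h.
  by apply: bump_out; left; exact: ltW.
by apply: bump_out; right; exact: ltW.
Qed.

(** The integral starts at a - 1, so that a is interior and the fundamental
    theorem of calculus applies at both ends of [a, b]. *)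
Lemma antiderivative a b f : a < b -> continuous f ->
  (forall t, t <= a \/ b <= t -> f t = 0) ->
  exists F : R -> R, [/\ forall t, a <= t <= b -> is_derive t 1 F (f t), F a = 0 &
    F b = \int[lebesgue_measure]_t f t].
Proof.
move=> ab cf f0; pose a' := a - 1; pose b' := b + 1.
pose F x := \int[lebesgue_measure]_(t in `[a', x]) f t.
have intf : lebesgue_measure.-integrable `[a', b'] (EFin \o f).
  apply: continuous_compact_integrable; first exact: segment_compact.
  exact: continuous_subspaceT.
exists F; split.
- move=> t /andP[ta tb].
  have tb' : t < b' by rewrite /b'; lra.
  have ta' : a' < t by rewrite /a'; lra.
  have [dF Ft] := continuous_FTC1_closed tb' intf ta' (cf t).
  exact: (DeriveDef dF (etrans (esym (derive1E F t)) Ft)).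
- rewrite /F (@eq_Rintegral _ _ _ _ _ (cst 0)).
    by rewrite Rintegral_cst// mul0r.
  by move=> t; rewrite inE/= in_itv/= => /andP[_ ta]; rewrite f0//; left.
- rewrite /F Rintegral_mkcond; apply: eq_Rintegral => t _.
  rewrite patchE; case: ifPn => //; rewrite notin_setE/= in_itv/= => /negP.
  rewrite negb_and -!ltNge => /orP[h|h]; rewrite f0//; last by right; exact: ltW.
  by left; move: h; rewrite /a'; lra.
Qed.

(** Take for phi a bump supported near x. A primitive of f phi' + g phi
    minus f phi has derivative (g - f') phi and, by the distributional
    identity, equal values at both ends of the support. By Rolle's theorem
    (g - f') phi vanishes inside, so f' = g somewhere near x. *)
Lemma distributional_derivative_pt f g (f' : R -> R) x :
  (forall t, is_derive t 1 f (f' t)) -> {for x, continuous f'} ->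
  continuous g -> distributional_derivative setT f g -> f' x = g x.
Proof.
move=> ff' cf' cg fg.
have near_eq e : 0 < e -> exists2 t, `|x - t| < e & f' t = g t.
  move=> e0; pose a := x - e; pose b := x + e.
  have ab : a < b by rewrite /a /b; lra.
  have cont h h' : (forall t, is_derive t 1 h (h' t)) -> continuous (h : R -> R).
    by move=> hh t; apply/differentiable_continuous/derivable1_diffP; case: (hh t).
  have phiE := bump_is_derive a b; set phi' := dbump a b in phiE.
  have cphi := cont _ _ phiE; have cf := cont _ _ ff'.
  have phi'1 : derive1 (bump a b) = phi'.
    by apply/funext => t; rewrite derive1E; have [_ ->] := phiE t.
  have cphi' : continuous phi'.
    have [h _ hE] := smooth_alg_derive (smooth_alg_derive1n 1 (smooth_alg_bump a b)).
    by apply: (cont _ h); rewrite -phi'1.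
  have phi'0 : forall t, t <= a \/ b <= t -> phi' t = 0 by exact: dbump_out.
  have [F [dF Fa Fb]] : exists F : R -> R,
      [/\ forall t, a <= t <= b -> is_derive t 1 F (f t * phi' t), F a = 0 &
      F b = \int[lebesgue_measure]_t (f t * phi' t)].
    apply: (@antiderivative a b (fun t => f t * phi' t)) => //.
      by move=> t; apply: cvgM; [exact: cf|exact: cphi'].
    by move=> t /phi'0 ->; rewrite mulr0.
  have [G [dG Ga Gb]] : exists F : R -> R,
      [/\ forall t, a <= t <= b -> is_derive t 1 F (g t * bump a b t), F a = 0 &
      F b = \int[lebesgue_measure]_t (g t * bump a b t)].
    apply: (@antiderivative a b (fun t => g t * bump a b t)) => //.
      by move=> t; apply: cvgM; [exact: cg|exact: cphi].
    by move=> t /bump_out ->; rewrite mulr0.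
  pose H t := F t + G t - f t * bump a b t.
  have dH t : a <= t <= b -> is_derive t 1 H ((g t - f' t) * bump a b t).
    move=> tab; have h1 := is_derive_mul (ff' t) (phiE t).
    have h2 := @is_deriveD R R R F G t 1 _ _ (dF _ tab) (dG _ tab).
    have h3 := @is_deriveB R R R _ _ t 1 _ _ h2 h1.
    by apply: (is_derive_eq h3); ring.
  have FGb : F b + G b = 0.
    have := fg _ (bump_test_function a b); rewrite Fb Gb.
    by rewrite phi'1 => ->; rewrite addNr.
  have Hab : H a = H b.
    by rewrite /H Fa Ga FGb !bump_out ?mulr0 ?addr0//; [right|left].
  have [t tab dHt] : exists2 t, t \in `]a, b[%R & is_derive t 1 H 0.
    apply: Rolle => //.
      move=> t; rewrite in_itv/= => /andP[ta tb].
      by have [] := dH t (introT andP (conj (ltW ta) (ltW tb))).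
    apply: derivable_within_continuous => t; rewrite in_itv/= => tab.
    by have [] := dH t tab.
  move: tab; rewrite in_itv/= => tab; exists t.
    by rewrite ltr_norml; move: tab; rewrite /a /b => /andP[? ?]; apply/andP; split; lra.
  have tab' : a <= t <= b by move: tab => /andP[? ?]; apply/andP; split; exact: ltW.
  have [_ e1] := dHt; have [_ e2] := dH t tab'.
  move: e1; rewrite e2 => /eqP; rewrite mulf_eq0 subr_eq0.
  by rewrite (gt_eqF (bump_gt0 tab)) orbF => /eqP.
apply/eqP/negPn/negP => ne.
have n0 : 0 < `|f' x - g x| by rewrite normr_gt0 subr_eq0.
have : (fun t => f' t - g t) @ x --> f' x - g x.
  by apply: cvgB; [exact: cf'|exact: cg].
move=> /cvgrPdist_lt/(_ _ n0)/nbhs_ballP[e /= e0 he].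
have [t xt ft] := near_eq _ e0.
have := he t; rewrite -ball_normE /= => /(_ xt).
by rewrite ft subrr subr0 ltxx.
Qed.

End Bump.

(** * Frechet derivatives and Taylor expansions *)

Section Frechet.
Variable R : realType.
Implicit Types U V W : normedModType R.

Lemma frechet_is_diff U V (f : U -> V) x :
  differentiable f x -> is_diff x f (frechet f x).
Proof.
move=> df; rewrite /frechet; case: xgetP => [y -> //|/= h].
have Lin : ('d f x : U -> V) \in @is_blin R U V.
  rewrite inE; split; last exact: diff_continuous.
  by move=> a y z; rewrite linearP.
by case: (h (Blin Lin)); apply: DiffDef.
Qed.

Lemma frechetE U V (f : U -> V) x v :
  differentiable f x -> frechet f x v = 'd f x v.
Proof. by move=> /frechet_is_diff[_ ->]. Qed.

Lemma is_diff_frechet U V (f : U -> V) x (L : blin U V) :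
  is_diff x f L -> frechet f x = L.
Proof.
move=> [df dL]; apply/val_inj/funext => v /=.
by rewrite frechetE// dL.
Qed.

Lemma is_diff_epsP U V (f : U -> V) x (L : blin U V) : is_diff x f L <->
  forall e, 0 < e -> \forall h \near (0 : U), `|f (h + x) - f x - L h| <= e * `|h|.
Proof.
split.
  move=> [df dL] e e0; have /eqaddoP/(_ e e0) := diff_locally df.
  by apply: filterS => h; rewrite /= !fctE /= dL /cst/= opprD addrA.
move=> h.
have fo : f \o shift x = cst (f x) + (L : {linear U -> V}) +o_ 0 id.
  apply/eqaddoP => e e0; have := h e e0.
  by apply: filterS => y; rewrite !fctE /cst/= opprD addrA.
have cL : continuous L by exact: blin_continuous.
have dfL := diff_unique cL fo.
by apply: DiffDef => //; apply/diff_locallyP; rewrite dfL.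
Qed.

Lemma is_derive_frechet U V (f : U -> V) (u : R -> U) (t : R) (u' : U) :
  is_derive t 1 u u' -> differentiable f (u t) ->
  is_derive t 1 (f \o u) (frechet f (u t) u').
Proof.
move=> [du <-] df; have du' : differentiable u t by exact/derivable1_diffP.
have dfu : differentiable (f \o u) t by exact: differentiable_comp.
apply: DeriveDef; first exact/derivable1_diffP.
by rewrite deriveE// diff_comp//= frechetE// deriveE.
Qed.

Lemma is_derive_blin U V (f : blin U V) (u : R -> U) (t : R) (u' : U) :
  is_derive t 1 u u' -> is_derive t 1 (fun t => f (u t)) (f u').
Proof.
move=> /is_derive_cvgP h; apply/is_derive_cvgP.
rewrite (_ : (fun _ => _) = f \o (fun h => h^-1 *: (u (h + t) - u t))); last first.
  by apply/funext => s /=; rewrite blinZ blinB.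
by apply: cvg_comp h _; exact: blin_continuous.
Qed.

Lemma near_norm V (x : V) e : 0 < e -> \forall y \near x, `|x - y| < e.
Proof. by move=> e0; apply/nbhs_normP; exists e. Qed.

Lemma ev_continuous U V (v : U) : continuous (fun L : blin U V => L v).
Proof.
move=> L; have FL : Filter (nbhs L) by exact: nbhs_filter.
apply/cvgrPdist_lt => e e0; have v0 : 0 < `|v| + 1 by rewrite ltr_wpDl.
have := @near_norm (blin U V) L _ (divr_gt0 e0 v0).
apply: filterS => M; rewrite ltr_pdivlMr//; apply: le_lt_trans.
apply: le_trans (blin_le_opnorm (L - M) v) _.
by apply: ler_pM => //; [exact: opnorm_ge0|rewrite lerDl].
Qed.

Lemma ev_is_blin U V (v : U) : (fun L : blin U V => L v) \in @is_blin R (blin U V) V.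
Proof. by rewrite inE; split; [move=> a L M|exact: ev_continuous]. Qed.

Definition ev_blin U V (v : U) : blin (blin U V) V := Blin (@ev_is_blin U V v).

Lemma cvg_blin_app (T : Type) (F : set_system T) (FF : Filter F) U V
    (L : T -> blin U V) (L0 : blin U V) (x : T -> U) x0 :
  L @ F --> L0 -> x @ F --> x0 -> L t (x t) @[t --> F] --> L0 x0.
Proof.
move=> hL hx; apply/cvgrPdist_lt => e e0; have e20 : 0 < e / 2 by rewrite divr_gt0.
have [K K0 L0K] := blin_bounded L0.
have K1 : 0 < K + 1 by rewrite addr_gt0.
have h1 : \forall t \near F, `|L0 x0 - L t x0| < e / 2.
  have k0 : 0 < `|x0| + 1 by rewrite ltr_wpDl.
  have h : \forall t \near F, `|L0 - L t| < e / 2 / (`|x0| + 1).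
    exact: hL (@near_norm (blin U V) L0 _ (divr_gt0 e20 k0)).
  apply: filterS h => t; rewrite /= ltr_pdivlMr//; apply: le_lt_trans.
  apply: le_trans (blin_le_opnorm (L0 - L t) x0) _.
  by apply: ler_pM => //; [exact: opnorm_ge0|rewrite lerDl].
have h2 : \forall t \near F, `|L0 - L t| < 1 by exact: hL (@near_norm (blin U V) L0 1 ltr01).
have h3 : \forall t \near F, `|x0 - x t| < e / 2 / (K + 1).
  by move: hx => /cvgrPdist_lt/(_ _ (divr_gt0 e20 K1)).
apply: filterS3 h1 h2 h3 => t h1 h2 h3.
have -> : L0 x0 - L t (x t) = (L0 x0 - L t x0) + L t (x0 - x t).
  by rewrite blinB addrA subrK.
apply: le_lt_trans (ler_normD _ _) _; rewrite [e]splitr ltr_leD//.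
apply: (@le_trans _ _ ((K + 1) * `|x0 - x t|)); last first.
  by rewrite mulrC -ler_pdivlMr// ltW.
have -> : L t (x0 - x t) = L0 (x0 - x t) - (L0 - L t) (x0 - x t).
  by rewrite -[(L0 - L t) _]/(L0 _ - L t _) opprB [RHS]addrC subrK.
apply: le_trans (ler_normB _ _) _; rewrite mulrDl lerD//.
apply: le_trans (blin_le_opnorm (L0 - L t) _) _.
by rewrite ler_wpM2r// ltW.
Qed.

Lemma line_is_derive V (a w : V) (t : R) : is_derive t 1 (fun t : R => a + t *: w) w.
Proof.
apply/is_derive_cvgP; apply: (@cvg_trans _ (cst w @ (0 : R)^')); last exact: cvg_cst.
apply: near_eq_cvg; near=> h.
have h0 : h != 0 by near: h; exact: nbhs_dnbhs_neq.
rewrite /cst opprD addrACA subrr add0r -scalerBl addrK scalerA mulVf//.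
by rewrite scale1r.
Unshelve. all: by end_near.
Qed.

Lemma differentiable_lipschitz U V (f : U -> V) x : differentiable f x ->
  exists C r : R, [/\ 0 < C, 0 < r &
    forall h, `|h| < r -> `|f (x + h) - f x| <= C * `|h|].
Proof.
move=> df; have [K K0 fK] := blin_bounded (frechet f x).
have /is_diff_epsP/(_ 1 ltr01) := frechet_is_diff df => /nbhs_ballP[r /= r0 hr].
exists (K + 1), r; split=> //; first by rewrite addr_gt0.
move=> h hlt; have : ball (0 : U) r h by rewrite -ball_normE /= sub0r normrN.
move=> /hr; rewrite /= mul1r (addrC h) => h1.
rewrite -[f _ - _](subrK (frechet f x h)) (le_trans (ler_normD _ _))//.
by rewrite mulrDl mul1r addrC lerD.
Qed.

Lemma is_diff_ext U V (A : set U) (f g : U -> V) x (L : blin U V) :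
  open A -> A x -> (forall y, A y -> f y = g y) -> is_diff x f L -> is_diff x g L.
Proof.
move=> oA Ax fg /is_diff_epsP hf; apply/is_diff_epsP => e e0.
have : \forall h \near (0 : U), A (h + x).
  apply: (@cvgD _ _ U _ _ id (fun=> x) 0 x); [exact: cvg_id|exact: cvg_cst|].
  by rewrite add0r; exact: open_nbhs_nbhs.
by apply: filterS2 (hf e e0) => h hh Ah; rewrite -!fg.
Qed.

Lemma blin_subZE U V (L M : blin U V) (c : R) x : (L - c *: M) x = L x - c *: M x.
Proof. by []. Qed.

Lemma is_diff_subZ U V (f g : U -> V) (c : R) x (L M : blin U V) :
  is_diff x f L -> is_diff x g M ->
  is_diff x (fun y => f y - c *: g y) (L - c *: M).
Proof. by move=> hf hg; exact: (is_diffB hf (is_diffZ c hg)). Qed.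

Lemma mvt01 (g dg : R -> R) (M : R) :
  (forall t : R, 0 <= t <= 1 -> is_derive t 1 g (dg t)) ->
  (forall t : R, 0 <= t <= 1 -> `|dg t| <= M) ->
  forall t : R, 0 <= t <= 1 -> `|g t - g 0| <= M.
Proof.
move=> gd dM t /andP[t0 t1].
have M0 : 0 <= M by apply: le_trans (dM 0 _); rewrite ?lexx ?ler01.
have [||s] := @MVT_segment R g dg 0 t t0.
- move=> s; rewrite in_itv/= => /andP[s0 st]; apply: gd.
  by rewrite (ltW s0) (le_trans (ltW st)).
- apply: derivable_within_continuous => s; rewrite in_itv/= => /andP[s0 st].
  by case: (gd s _) => //; rewrite s0 (le_trans st).
rewrite in_itv/= subr0 => /andP[s0 st] ->; rewrite normrM (ger0_norm t0).
rewrite -[leRHS]mulr1; apply: ler_pM => //; apply: dM.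
by rewrite s0 (le_trans st).
Qed.

Lemma open_segment V (A : set V) x : open A -> A x ->
  exists2 r : R, 0 < r & forall w, `|w| < r -> forall t : R, 0 <= t <= 1 -> A (x + t *: w).
Proof.
move=> oA Ax; have /nbhs_normP[r /= r0 hr] : nbhs x A by exact: open_nbhs_nbhs.
exists r => // w wr t /andP[t0 t1]; apply: hr => /=.
rewrite opprD addrA subrr sub0r normrN normrZ ger0_norm//.
by apply: le_lt_trans wr; rewrite ler_piMl.
Qed.

(** The mean value theorem along the segment, the derivative of f being
    Lipschitz at x. *)
Lemma taylor1 V (A : set V) (f : V -> R) x : open A -> A x ->
  (forall y, A y -> differentiable f y) -> differentiable (frechet f) x ->
  exists C r : R, [/\ 0 < C, 0 < r & forall w, `|w| < r ->
    `|f (x + w) - f x - frechet f x w| <= C * `|w| ^+ 2].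
Proof.
move=> oA Ax df d2f; have [r1 r10 seg] := open_segment oA Ax.
have [C [r2 [C0 r20 lip]]] := differentiable_lipschitz d2f.
exists C, (Num.min r1 r2); split=> //; first by rewrite lt_min r10.
move=> w; rewrite lt_min => /andP[wr1 wr2].
pose g (t : R) := f (x + t *: w) - t * frechet f x w.
pose dg (t : R) := frechet f (x + t *: w) w - frechet f x w.
have := @mvt01 g dg (C * `|w| ^+ 2) _ _ 1; rewrite ler01 lexx.
rewrite /g !scale0r !scale1r addr0 mul0r mul1r subr0 addrAC; apply => //.
- move=> t t01; have := @line_is_derive V x w t.
  move=> /is_derive_frechet-/(_ _ f (df _ (seg _ wr1 _ t01))) h1.
  have h2 := is_derive_mul (@is_derive_id R R t 1)
    (@is_derive_cst R R R (frechet f x w) t 1).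
  have h3 := @is_deriveB R R R _ _ t 1 _ _ h1 h2.
  by apply: (is_derive_eq h3); rewrite /dg /cst/= mul1r mulr0 addr0.
- move=> t /andP[t0 t1]; rewrite /dg.
  have tw : `|t *: w| <= `|w| by rewrite normrZ ger0_norm// ler_piMl.
  apply: le_trans (blin_le_opnorm (frechet f (x + t *: w) - frechet f x) w) _.
  rewrite expr2 mulrA ler_wpM2r//.
  apply: le_trans (lip _ (le_lt_trans tw wr2)) _.
  by rewrite ler_pM2l.
Qed.

(** The mean value theorem twice along the segment, the second derivative of
    f being Lipschitz at x. *)
Lemma taylor2 V (A : set V) (f : V -> R) x : open A -> A x ->
  (forall y, A y -> differentiable f y) ->
  (forall y, A y -> differentiable (frechet f) y) ->
  differentiable (frechet (frechet f)) x ->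
  exists C r : R, [/\ 0 < C, 0 < r & forall w, `|w| < r ->
    `|f (x + w) - f x - frechet f x w - 2^-1 * frechet (frechet f) x w w|
      <= C * `|w| ^+ 3].
Proof.
move=> oA Ax df d2f d3f; have [r1 r10 seg] := open_segment oA Ax.
have [C [r2 [C0 r20 lip]]] := differentiable_lipschitz d3f.
exists C, (Num.min r1 r2); split=> //; first by rewrite lt_min r10.
move=> w; rewrite lt_min => /andP[wr1 wr2].
pose a := frechet f x w; pose b := frechet (frechet f) x w w.
pose g (t : R) := f (x + t *: w) - t * a - 2^-1 * (t * t) * b.
pose dg (t : R) := frechet f (x + t *: w) w - a - t * b.
pose h (t : R) := frechet f (x + t *: w) w - t * b.
pose dh (t : R) := frechet (frechet f) (x + t *: w) w w - b.
have line (t : R) := @line_is_derive V x w t.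
have lin (t k : R) : is_derive t 1 (fun t : R => t * k) k.
  have h2 := is_derive_mul (@is_derive_id R R t 1) (@is_derive_cst R R R k t 1).
  by apply: (is_derive_eq h2); rewrite /cst/= mul1r mulr0 addr0.
have gd (t : R) : 0 <= t <= 1 -> is_derive t 1 g (dg t).
  move=> t01.
  have h1 := is_derive_frechet (line t) (df _ (seg _ wr1 _ t01)).
  have h2 := @is_deriveB R R R _ _ t 1 _ _ h1 (lin t a).
  have h3 := is_derive_mul (@is_derive_id R R t 1) (@is_derive_id R R t 1).
  have h4 := is_derive_mul (@is_derive_cst R R R 2^-1 t 1) h3.
  have h5 := is_derive_mul h4 (@is_derive_cst R R R b t 1).
  have h6 := @is_deriveB R R R _ _ t 1 _ _ h2 h5.
  by apply: (is_derive_eq h6); rewrite /dg /cst/= -/a; field.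
have hd (t : R) : 0 <= t <= 1 -> is_derive t 1 h (dh t).
  move=> t01.
  have h1 := is_derive_frechet (line t) (d2f _ (seg _ wr1 _ t01)).
  have h2 := is_derive_blin (ev_blin R w) h1.
  exact: (@is_deriveB R R R _ _ t 1 _ _ h2 (lin t b)).
have dhM (t : R) : 0 <= t <= 1 -> `|dh t| <= C * `|w| ^+ 3.
  move=> /andP[t0 t1]; rewrite /dh /b.
  have tw : `|t *: w| <= `|w| by rewrite normrZ ger0_norm// ler_piMl.
  set L := frechet (frechet f).
  apply: le_trans (blin_le_opnorm ((L (x + t *: w) - L x) w) w) _.
  rewrite exprSr mulrA ler_wpM2r//.
  apply: le_trans (blin_le_opnorm (L (x + t *: w) - L x) w) _.
  rewrite expr2 mulrA ler_wpM2r//.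
  apply: le_trans (lip _ (le_lt_trans tw wr2)) _.
  by rewrite ler_pM2l.
(* Since dg t = h t - h 0, a bound of the derivative dh of h bounds dg. *)
have dgM (t : R) : 0 <= t <= 1 -> `|dg t| <= C * `|w| ^+ 3.
  move=> t01; have := mvt01 hd dhM t01.
  by rewrite /h scale0r addr0 mul0r subr0 addrAC.
have := mvt01 gd dgM (t := 1); rewrite ler01 lexx => /(_ isT).
rewrite /g !scale0r !scale1r addr0 !mul0r !mulr0 !mul1r mul0r !subr0 mulr1.
suff -> : f (x + w) - a - 2^-1 * b - f x = f (x + w) - f x - a - 2^-1 * b by [].
by ring.
Qed.

End Frechet.

Lemma within_continuous_comp (R : realType) (W : normedModType R) (A : set R)
    (u : R -> W) (g : W -> R) :
  {within A, continuous u} -> continuous g -> {within A, continuous (g \o u)}.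
Proof.
by move=> cu cg x; apply: cvg_comp (cu x) _; exact: cg.
Qed.

(** * Restrictions of a group of affine isometries *)

Section AffineGroup.
Variables (R : realType) (X Y : normedModType R).
Variables (T : R -> X -> X) (S : R -> Y -> Y) (j : Y -> X).

(** S is the restriction of the group T along an embedding j. This covers
    the groups on X, V and W, and the group on W seen in V. *)
Record isometric_lift : Prop := IsometricLift {
  lift_base_linear : forall s, linear (fun x => T s x - T s 0) ;
  lift_base_0 : forall x, T 0 x = x ;
  lift_base_D : forall s r x, T (s + r) x = T s (T r x) ;
  lift_emb_linear : linear j ;
  lift_emb_inj : injective j ;
  lift_emb_continuous : continuous j ;
  lift_emb : forall s y, j (S s y) = T s (j y) ;
  lift_isometry : forall s y, `|S s y - S s 0| = `|y| }.

Hypothesis HL : isometric_lift.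
Let T_lin := lift_base_linear HL.
Let T_0 := lift_base_0 HL.
Let T_D := lift_base_D HL.
Let j_lin := lift_emb_linear HL.
Let j_inj := lift_emb_inj HL.
Let j_cont := lift_emb_continuous HL.
Let jS := lift_emb HL.
Let S_iso := lift_isometry HL.

Let jB x y : j (x - y) = j x - j y.
Proof. by have := j_lin (-1) y x; rewrite !scaleN1r ![- _ + _]addrC. Qed.

Let j0 : j 0 = 0.
Proof. by have := jB 0 0; rewrite !subrr. Qed.

Let jZ a x : j (a *: x) = a *: j x.
Proof. by have := j_lin a x 0; rewrite !addr0 j0 addr0. Qed.

Lemma lift_0 y : S 0 y = y.
Proof. by apply: j_inj; rewrite jS T_0. Qed.

Lemma lift_D s r y : S (s + r) y = S s (S r y).
Proof. by apply: j_inj; rewrite !jS T_D. Qed.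

Lemma lift_K s y : S (- s) (S s y) = y.
Proof. by rewrite -lift_D addNr lift_0. Qed.

Lemma lift_NK s y : S s (S (- s) y) = y.
Proof. by rewrite -lift_D subrr lift_0. Qed.

Lemma lift_linear s : linear (fun y => S s y - S s 0).
Proof.
move=> a y z; apply: j_inj; rewrite j_lin !jB !jS j_lin j0.
exact: T_lin.
Qed.

Lemma lift_sub s y z : S s y - S s z = S s (y - z) - S s 0.
Proof.
have := lift_linear s (-1) z y; rewrite !scaleN1r ![- _ + _]addrC /= => ->.
by rewrite opprB addrA subrK.
Qed.

Lemma lift_dist s y z : `|S s y - S s z| = `|y - z|.
Proof. by rewrite lift_sub S_iso. Qed.

Lemma lift_continuous s : continuous (S s).
Proof.
move=> y; apply/cvgrPdist_lt => e e0.
have := near_norm y e0.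
by apply: filterS => z; rewrite lift_dist.
Qed.

(** S (h + r) y - S r y is the image of S h y - y under the linear part of S
    r. *)
Lemma lift_is_derive (r : R) y : gen_dom S y ->
  is_derive r 1 (fun s => S s y) (S r (gen S y) - S r 0).
Proof.
move=> /cvg_ex[l hl]; have -> : gen S y = l by exact: cvg_lim.
apply/is_derive_cvgP.
rewrite (_ : (fun h : R => _) = (fun z => S r z - S r 0) \o
    (fun s => s^-1 *: (S s y - y))); last first.
  apply/funext => h /=; rewrite (addrC h) lift_D lift_sub.
  have := lift_linear r h^-1 (S h y - y) 0.
  by rewrite !addr0 subrr addr0.
apply: cvg_comp hl _; apply: cvgB; last exact: cvg_cst.
exact: lift_continuous.
Qed.

Lemma lift_gen (r : R) y : gen_dom S y ->
  gen_dom S (S r y) /\ gen S (S r y) = S r (gen S y) - S r 0.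
Proof.
move=> /(lift_is_derive r)/is_derive_cvgP.
rewrite (_ : (fun h : R => _) = fun s => s^-1 *: (S s (S r y) - S r y)).
  by move=> h; split; [apply/cvg_ex; eexists; exact: h|exact: cvg_lim].
by apply/funext => h; rewrite lift_D.
Qed.

Lemma lift_gen_image y : gen_dom S y ->
  gen_dom T (j y) /\ gen T (j y) = j (gen S y).
Proof.
move=> /cvg_ex[l hl]; have -> : gen S y = l by exact: cvg_lim.
have h : s^-1 *: (T s (j y) - j y) @[s --> (0 : R)^'] --> j l.
  rewrite (_ : (fun s : R => _) = j \o (fun s => s^-1 *: (S s y - y))).
    by apply: cvg_comp hl _; exact: j_cont.
  by apply/funext => s /=; rewrite jZ jB jS.
by split; [apply/cvg_ex; eexists; exact: h|exact: cvg_lim].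
Qed.

End AffineGroup.

(** * Invariance of P, criticality and the second variation *)

Section Setting.
Variables (R : realType) (S : setting R).
Hypotheses (hS : assumption_spaces S) (hA2 : assumption2 S) (hA3 : assumption3 S)
  (hA4 : assumption4 S) (hA5 : assumption5 S)
  (hA1 : assumption1 S) (hA6 : assumption6 S).
Local Notation X := (Xs S).
Local Notation V := (Vs S).
Local Notation W := (Ws S).

Lemma embV_inj : injective (embV S). Proof. by case: hS. Qed.

Lemma embW_inj : injective (@embW R S).
Proof. by case: hS => iV iW _ _ _ x y /iV/iW. Qed.

Lemma embW_linear : linear (@embW R S).
Proof. by move=> a x y; rewrite /embW !linearP. Qed.

Lemma embW_continuous : continuous (@embW R S).
Proof.
move=> x; apply: continuous_comp; exact: blin_continuous.
Qed.

Lemma dT_linear s : linear (fun x => T S s x - T S s 0).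
Proof. by case: hA4 => + _ => /(_ s). Qed.

Lemma T_0 x : T S 0 x = x.
Proof. by case: hA4 => _ [[_ [+ _] _ _] _]. Qed.

Lemma T_D s r x : T S (s + r) x = T S s (T S r x).
Proof. by case: hA4 => _ [[_ [_ +] _ _] _]. Qed.

Lemma dT_norm s x : `|T S s x - T S s 0| = `|x|.
Proof.
case: hA4 => _ [[_ _ [+ _ _ _] _] _] => /(_ s x x); rewrite !ip_norm => h.
by apply/eqP; rewrite -(@eqrXn2 _ 2)//; apply/eqP.
Qed.

Lemma embV_TV s v : embV S (TV S s v) = T S s (embV S v).
Proof. by case: hA4 => _ [[[_ h _ _] _ _ _] _]; exact: h. Qed.

Lemma embW_TW s w : embW (TW S s w) = T S s (embW w).
Proof. by case: hA4 => _ [[[_ _ h _] _ _ _] _]; exact: h. Qed.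

Lemma dTV_norm s v : `|TV S s v - TV S s 0| = `|v|.
Proof. by case: hA4 => _ [[_ _ [_ _ h _] _] _]; exact: h. Qed.

Lemma dTW_norm s w : `|TW S s w - TW S s 0| = `|w|.
Proof. by case: hA4 => _ [[_ _ [_ _ _ h] _] _]; exact: h. Qed.

Lemma embWV_TW s w : embWV S (TW S s w) = TV S s (embWV S w).
Proof. by apply: embV_inj; rewrite embV_TV; exact: embW_TW. Qed.

Lemma OV_open : open (@OV R S).
Proof.
case: hS => _ _ _ _ oO.
by apply: open_comp oO => v _; exact: blin_continuous.
Qed.

Lemma OV_TV s v : OV v -> OV (TV S s v).
Proof. by rewrite /OV/= embV_TV; case: hA4 => _ [[[+ _ _ _] _ _ _] _]; apply. Qed.

Lemma liftX : isometric_lift (T S) (T S) id.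
Proof.
split=> //; [exact: dT_linear|exact: T_0|exact: T_D|by move=> x; exact: cvg_id|exact: dT_norm].
Qed.

Lemma liftV : isometric_lift (T S) (TV S) (embV S).
Proof.
split; [exact: dT_linear|exact: T_0|exact: T_D|exact: blin_linear|exact: embV_inj|
  exact: blin_continuous|exact: embV_TV|exact: dTV_norm].
Qed.

Lemma liftW : isometric_lift (T S) (TW S) (@embW R S).
Proof.
split; [exact: dT_linear|exact: T_0|exact: T_D|exact: embW_linear|exact: embW_inj|
  exact: embW_continuous|exact: embW_TW|exact: dTW_norm].
Qed.

Lemma liftWV : isometric_lift (TV S) (TW S) (embWV S).
Proof.
split; [exact: (lift_linear liftV)|exact: (lift_0 liftV)|exact: (lift_D liftV)|
  exact: blin_linear|by case: hS|exact: blin_continuous|exact: embWV_TW|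
  exact: dTW_norm].
Qed.

Lemma E_diff u : OV u -> differentiable (E S) u.
Proof. by case: hA3 => -[[+ _] _] _ _ _; apply. Qed.

Lemma P_diff u : OV u -> differentiable (P S) u.
Proof. by case: hA3 => -[_ [+ _]] _ _ _; apply. Qed.

Lemma gradE_embV u v : OV u -> gradE S u (embV S v) = frechet (E S) u v.
Proof. by case: hA3 => _ _ + _ => h /h/(_ v). Qed.

Lemma gradP_embV u v : OV u -> gradP S u (embV S v) = frechet (P S) u v.
Proof. by case: hA3 => _ _ _ h /h/(_ v). Qed.

Lemma J_skew u v w : OV u -> Jdom S v -> Jdom S w -> w (J u v) = - v (J u w).
Proof. by case: hA2 => _ _ _ _ h Ou; exact: h. Qed.

Lemma T'_gradP u : domT'V u -> OV u ->
  Jdom S (gradP S u) /\ gen (T S) (embV S u) = J u (gradP S u).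
Proof. by case: hA4 => _ [_ [_ _ [_ h _] _ _]]; exact: h. Qed.

(** Along the group the derivative of P is grad P applied to J grad P, which
    is 0 since J is skew. *)
Lemma P_invariant_dom u s : domT'V u -> OV u -> P S (TV S s u) = P S u.
Proof.
move=> du Ou; have dP (t : R) : is_derive t 1 (fun s => P S (TV S s u)) 0.
  have Ot := OV_TV t Ou; have [gt gE] := lift_gen liftV t du.
  have [_ gX] := lift_gen_image liftV gt.
  have [JP TJ] := T'_gradP gt Ot.
  have h := is_derive_frechet (lift_is_derive liftV t du) (P_diff Ot).
  apply: (is_derive_eq h); rewrite -gE -gradP_embV// -gX TJ.
  have := J_skew Ot JP JP; set a := gradP S _ _ => aa; lra.
have := is_derive_0_is_cst s 0 dP; rewrite (lift_0 liftV u); apply.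
Qed.

(** The domain of the generator is dense, and both sides are continuous. *)
Lemma P_invariant u s : OV u -> P S (TV S s u) = P S u.
Proof.
move=> Ou; apply/eqP/negPn/negP => ne.
pose F v := P S (TV S s v) - P S v.
have n0 : 0 < `|F u| by rewrite normr_gt0 subr_eq0.
have cF : F v @[v --> u] --> F u.
  apply: cvgB; last exact: differentiable_continuous (P_diff Ou).
  apply: (@continuous_comp _ _ _ (TV S s) (P S)); first exact: (lift_continuous liftV).
  exact: differentiable_continuous (P_diff (OV_TV s Ou)).
have nF : nbhs u (@OV R S `&` [set v | F v != 0]).
  apply: filterI; first by apply: open_nbhs_nbhs; split => //; exact: OV_open.
  have /cvgrPdist_lt/(_ _ n0) := cF; apply: filterS => v /= h.
  by apply/eqP => Fv; move: h; rewrite Fv subr0 ltxx.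
have [A [oA Au AF]] : exists A, [/\ open A, A u & A `<=` @OV R S `&` [set v | F v != 0]].
  by move: nF; rewrite nbhsE => -[A [oA Au] AF]; exists A.
have dV : dense (@domT'V R S) by case: hA4 => _ [_ [_ _ [[_ + _] _ _] _ _]].
have [v [Av dv]] := dV A (ex_intro _ u Au) oA.
have [Ov /eqP] := AF _ Av; apply.
by rewrite /F P_invariant_dom// subrr.
Qed.

Lemma OV_U c : Iset S c -> OV (embWV S (U S c)).
Proof. by case: hA5 => _ + _ _ => /(_ c) h /h[]. Qed.

Lemma domT'_U c : Iset S c -> gen_dom (T S) (embW (U S c)).
Proof. by case: hA5 => _ _ _ + => /(_ c) h /h[[]]. Qed.

Lemma gradE_continuous u : OV u -> gradE S x @[x --> u] --> gradE S u.
Proof. by case: hA3 => _ [h _] _ _; exact: h. Qed.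

Lemma Bop_continuous u : OV u -> Bop S x @[x --> u] --> Bop S u.
Proof.
by case: hA2 => _ _ _ [[h _] _] _ => /h; exact: differentiable_continuous.
Qed.

Lemma Jrange_dense : dense (Jhat S @` Jdom S).
Proof.
have : dense ((@embW R S @` @domT'W R S) `&` (Jhat S @` Jdom S)).
  by case: hA4 => _ [_ []].
by move=> h A A0 oA; have [x [Ax [_ Jx]]] := h A A0 oA; exists x.
Qed.

Lemma Bop_surj u x : OV u -> exists y, Bop S u y = x.
Proof.
case: hA2 => _ + _ _ _ => h /h[g _ gK].
by exists (g x); rewrite gK.
Qed.

(** The equation satisfied by t -> T (c t) U_c, read at t = 0: the velocity
    there is c T'(0) U_c = c J grad P, and skewness of J moves it onto w. *)
Lemma gradEP_weak c w : Iset S c -> Jdom S w -> let v := embWV S (U S c) in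
  gradE S v (J v w) = c * gradP S v (J v w).
Proof.
move=> Ic Jw v.
have [_ _ [OWt _ dd _ _]] : bound_state c (U S c) by case: hA5 => _ + _ _; apply.
have Ov t : OV (TV S (c * t) v) by rewrite -embWV_TW; exact: OWt.
have {}dd := dd w Jw; rewrite interiorT in dd.
set f := (fun t => w _) in dd; set g := (fun t => - _) in dd.
pose u := embW (U S c); pose Tu := gen (T S) u.
have df (t : R) : is_derive t 1 f (w (T S (c * t) Tu - T S (c * t) 0) * c).
  have h := is_derive_blin w (lift_is_derive liftX (c * t) (domT'_U Ic)).
  have hc : is_derive t 1 (fun t : R => c * t) c.
    have h2' := is_derive_mul (@is_derive_cst R R R c t 1) (@is_derive_id R R t 1).
    by apply: (is_derive_eq h2'); rewrite /cst/= mul0r mulr1 add0r.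
  have := @is_derive1_comp R (fun s => w (T S s u)) (fun t => c * t) t _ _ h hc.
  rewrite (_ : _ \o _ = f)//.
  by apply/funext => s; rewrite /f /= embW_TW.
have cct : continuous (fun t : R => c * t).
  by move=> t; apply: cvgMl_tmp; exact: cvg_id.
have cT x : continuous (fun t : R => T S (c * t) x).
  move=> t; apply: (@continuous_comp _ _ _ (fun t : R => c * t) (fun s => T S s x)).
    exact: cct.
  by case: hA4 => _ [[_ _ _ [h _ _]] _]; exact: h.
have cdf : {for 0, continuous (fun t => w (T S (c * t) Tu - T S (c * t) 0) * c)}.
  apply: cvgMr_tmp.
  apply: (@continuous_comp _ _ _ (fun t : R => T S (c * t) Tu - T S (c * t) 0) w).
    by apply: cvgB; exact: cT.
  exact: blin_continuous.
have cg : continuous g.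
  move=> t; rewrite /g; apply: cvgN.
  have cv : embWV S (TW S (c * s) (U S c)) @[s --> t] --> TV S (c * t) v.
    rewrite (_ : (fun s => _) = (fun s => TV S (c * s) v)); last first.
      by apply/funext => s; rewrite embWV_TW.
    apply: (@continuous_comp _ _ _ (fun t : R => c * t) (fun s => TV S s v)).
      exact: cct.
    by case: hA4 => _ [[_ _ _ [_ h _]] _]; exact: h.
  rewrite embWV_TW.
  apply: (@cvg_blin_app R R (nbhs t) _ X R).
    exact: cvg_comp cv (gradE_continuous (Ov t)).
  apply: (@cvg_blin_app R R (nbhs t) _ X X); last exact: cvg_cst.
  exact: cvg_comp cv (Bop_continuous (Ov t)).
have := distributional_derivative_pt df cdf cg dd.
rewrite /g !mulr0 !(lift_0 liftX) subr0 embWV_TW (lift_0 liftV) -/v /Tu.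
have dv : domT'V v.
  have dW : domT'W (U S c) by case: hA5 => _ _ _ /(_ _ Ic)[[]].
  exact: (lift_gen_image liftWV dW).1.
have [JP ->] := T'_gradP dv (OV_U Ic).
rewrite (J_skew (OV_U Ic) JP Jw) => h.
by rewrite -[LHS]opprK -h; ring.
Qed.

(** U_c is a critical point of E - c P: the difference of the gradients
    vanishes on the image under B(U_c) of the range of Jhat, which is dense
    since that range is dense and B(U_c) is onto. *)
Lemma critical c : Iset S c ->
  gradE S (embWV S (U S c)) = c *: gradP S (embWV S (U S c)).
Proof.
move=> Ic; set v := embWV S (U S c); have Ov : OV v := OV_U Ic.
pose D := gradE S v - c *: gradP S v.
have D0 w : Jdom S w -> D (J v w) = 0.
  move=> Jw; have := gradEP_weak Ic Jw; rewrite -/v /= => h.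
  by rewrite -[LHS]/(gradE S v _ - c * gradP S v _) h subrr.
have DB0 x : D (Bop S v x) = 0.
  apply/eqP/negPn/negP => ne.
  have n0 : 0 < `|D (Bop S v x)| by rewrite normr_gt0.
  have cDB : D (Bop S v y) @[y --> x] --> D (Bop S v x).
    apply: (@continuous_comp _ _ _ (Bop S v) D); exact: blin_continuous.
  have nA : nbhs x [set y | D (Bop S v y) != 0].
    move: cDB => /cvgrPdist_lt/(_ _ n0); apply: filterS => y /= h.
    by apply/eqP => Dy; move: h; rewrite Dy subr0 ltxx.
  move: nA; rewrite nbhsE => -[A [oA Ax] AD].
  have [y [Ay [w Jw wy]]] := Jrange_dense (ex_intro _ x Ax) oA.
  by have /eqP := AD _ Ay; apply; rewrite -wy; exact: D0.
apply/eqP; rewrite -subr_eq0; apply/eqP/val_inj/funext => x.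
by have [y <-] := Bop_surj x Ov; exact: DB0.
Qed.

Lemma critical_frechet c v : Iset S c ->
  frechet (E S) (embWV S (U S c)) v = c * frechet (P S) (embWV S (U S c)) v.
Proof.
move=> Ic; have Ov := OV_U Ic.
by rewrite -(gradE_embV _ Ov) -(gradP_embV _ Ov) critical.
Qed.

Definition dU c : W := frechet (U S) c 1.

Lemma U_is_derive c : Iset S c -> is_derive c 1 (U S) (dU c).
Proof.
case: hA5 => _ _ [h _] _ /h dUc.
apply: DeriveDef; first exact/derivable1_diffP.
by rewrite deriveE// /dU frechetE.
Qed.

Lemma embWV_U_is_derive c : Iset S c ->
  is_derive c 1 (fun c => embWV S (U S c)) (embWV S (dU c)).
Proof. by move=> Ic; exact: is_derive_blin (U_is_derive Ic). Qed.

Lemma nbhs_Iset c : Iset S c -> nbhs c (Iset S).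
Proof.
by move=> Ic; apply: open_nbhs_nbhs; split=> //; case: hA5 => -[_ oI _] _ _ _.
Qed.

(** The contribution of the derivative of c -> U_c vanishes, U_c being
    critical for E - c P. *)
Lemma moment_is_derive c : Iset S c ->
  is_derive c 1 (moment S) (- P S (embWV S (U S c))).
Proof.
move=> Ic; have h := embWV_U_is_derive Ic; have Ov := OV_U Ic.
have hE := is_derive_frechet h (E_diff Ov).
have hP := is_derive_frechet h (P_diff Ov).
have h1 := is_derive_mul (@is_derive_id R R c 1) hP.
have h2' := @is_deriveB R R R _ _ c 1 _ _ hE h1.
by apply: (is_derive_eq h2'); rewrite /= critical_frechet//; ring.
Qed.

Lemma moment_derive2 c : Iset S c ->
  derive1n 2 (moment S) c = - frechet (P S) (embWV S (U S c)) (embWV S (dU c)).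
Proof.
move=> Ic; rewrite derive1nS derive1n1 derive1E.
have hP := is_derive_frechet (embWV_U_is_derive Ic) (P_diff (OV_U Ic)).
have := @is_deriveN R R R _ c 1 _ hP => -[_ <-].
apply: near_eq_derive; apply: filterS (nbhs_Iset Ic) => s Is.
by rewrite derive1E; have [_ ->] := moment_is_derive Is.
Qed.

Lemma Ec_is_diff c y : OV y ->
  is_diff y (@Ec R S c) (frechet (E S) y - c *: frechet (P S) y).
Proof.
move=> Oy.
exact: is_diff_subZ (frechet_is_diff (E_diff Oy)) (frechet_is_diff (P_diff Oy)).
Qed.

Lemma Ec_frechet c y : OV y ->
  frechet (@Ec R S c) y = frechet (E S) y - c *: frechet (P S) y.
Proof. by move=> Oy; apply: is_diff_frechet; exact: Ec_is_diff. Qed.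

Lemma E_diff2 u : OV u -> differentiable (frechet (E S)) u.
Proof. by case: hA3 => -[[_ [h _]] _] _ _ _; exact: h. Qed.

Lemma P_diff2 u : OV u -> differentiable (frechet (P S)) u.
Proof. by case: hA3 => -[_ [_ [h _]]] _ _ _; exact: h. Qed.

Lemma Ec_frechet_is_diff c u : OV u -> is_diff u (frechet (@Ec R S c))
  (frechet (frechet (E S)) u - c *: frechet (frechet (P S)) u).
Proof.
move=> Ou.
have key := is_diff_subZ c (frechet_is_diff (E_diff2 Ou)) (frechet_is_diff (P_diff2 Ou)).
apply: is_diff_ext OV_open Ou _ key => y Oy.
by rewrite (Ec_frechet c Oy).
Qed.

Lemma Ec_frechet2 c u : OV u -> frechet (frechet (@Ec R S c)) u =
  frechet (frechet (E S)) u - c *: frechet (frechet (P S)) u.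
Proof. by move=> Ou; apply: is_diff_frechet; exact: Ec_frechet_is_diff. Qed.

Lemma Ec_frechet2_diff c u : OV u -> differentiable (frechet (frechet (@Ec R S c))) u.
Proof.
move=> Ou; have [[[_ [_ [dE _]]] [_ [_ [dP _]]]] _ _ _] := hA3.
have key := is_diff_subZ c (frechet_is_diff (dE _ Ou)) (frechet_is_diff (dP _ Ou)).
have agree y : OV y -> frechet (frechet (E S)) y - c *: frechet (frechet (P S)) y =
    frechet (frechet (@Ec R S c)) y by move=> Oy; rewrite (Ec_frechet2 c Oy).
by have [] := is_diff_ext OV_open Ou agree key.
Qed.

(** Derivative in c of the identity DE(U_c) v - c DP(U_c) v = 0. With
    moment_derive2 it shows that the second variation at the derivative of c
    -> U_c is - d''(c). *)
Lemma D2Ec_dU c v : Iset S c ->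
  frechet (frechet (@Ec R S c)) (embWV S (U S c)) (embWV S (dU c)) v =
  frechet (P S) (embWV S (U S c)) v.
Proof.
move=> Ic; have Ov := OV_U Ic; rewrite (Ec_frechet2 c Ov).
set u := embWV S (U S c) in Ov *.
have hu := embWV_U_is_derive Ic.
pose phi (s : R) := frechet (E S) (embWV S (U S s)) v -
  s * frechet (P S) (embWV S (U S s)) v.
have dphi : is_derive c 1 phi 0.
  apply: (@near_eq_is_derive R R R (cst 0)).
  by apply: filterS (nbhs_Iset Ic) => s Is; rewrite /phi critical_frechet// subrr.
have hE := is_derive_blin (ev_blin R v) (is_derive_frechet hu (E_diff2 Ov)).
have hP := is_derive_blin (ev_blin R v) (is_derive_frechet hu (P_diff2 Ov)).
have h1 := is_derive_mul (@is_derive_id R R c 1) hP.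
have h3' := @is_deriveB R R R _ _ c 1 _ _ hE h1.
have [_ e1] := dphi; have [_ e2] := h3'.
have e3 := etrans (esym e2) e1; rewrite /= -/u mul1r in e3.
rewrite !blin_subZE; apply/eqP; rewrite -subr_eq0; apply/eqP.
by rewrite -[RHS]e3 /GRing.scale/=; ring.
Qed.

(** * The Lyapunov functional *)

(** For |w|_W <= M the interpolation inequality reads |w|_V^3 <= B
    |w|_X^theta |w|_X^2 with B = C M^(1 - theta), so that terms cubic in V
    are negligible against |w|_X^2. *)
Lemma interpolation (M eta r : R) : 0 < M -> 0 < eta -> 0 < r ->
  exists2 rho : R, 0 < rho & forall w : W, `|w| <= M -> `|embW w| < rho ->
    `|embWV S w| ^+ 3 <= eta * `|embW w| ^+ 2 /\ `|embWV S w| < r.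
Proof.
move=> M0 eta0 r0; have [theta [C [th0 th1 C0 H]]] := hA1.
pose B := C * M `^ (1 - theta).
have B0 : 0 < B by rewrite mulr_gt0// powR_gt0.
pose rho1 := (eta / B) `^ theta^-1; pose rho2 := Num.min 1 (r ^+ 3 / eta).
have rho10 : 0 < rho1 by rewrite powR_gt0// divr_gt0.
have rho20 : 0 < rho2 by rewrite lt_min ltr01 divr_gt0// exprn_gt0.
exists (Num.min rho1 rho2); first by rewrite lt_min rho10.
move=> w wM; rewrite lt_min lt_min => /and3P[x1 x2 x3].
set x := `|embW w| in x1 x2 x3 *; have x0 : 0 <= x by exact: normr_ge0.
have small : x `^ theta <= eta / B.
  have -> : eta / B = rho1 `^ theta.
    by rewrite /rho1 -powRrM mulVf ?gt_eqF// powRr1// ltW// divr_gt0.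
  by apply: ge0_ler_powR; rewrite ?nnegrE// ltW.
have cube : `|embWV S w| ^+ 3 <= eta * x ^+ 2.
  apply: le_trans (H w) _; rewrite -/x powRD; last by rewrite gt_eqF// addr_gt0.
  rewrite -[2]/(2%:R) powR_mulrn//.
  have h : `|w| `^ (1 - theta) <= M `^ (1 - theta).
    by apply: ge0_ler_powR; rewrite ?nnegrE ?subr_ge0// ltW.
  apply: (@le_trans _ _ (C * (x ^+ 2 * x `^ theta) * M `^ (1 - theta))).
    by rewrite ler_wpM2l// mulr_ge0 ?(ltW C0)// mulr_ge0 ?powR_ge0// exprn_ge0.
  have -> : C * (x ^+ 2 * x `^ theta) * M `^ (1 - theta) =
    B * x `^ theta * x ^+ 2 by rewrite /B; ring.
  rewrite ler_wpM2r ?sqr_ge0// mulrC -ler_pdivlMr//.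
split=> //; rewrite ltNge; apply/negP => rv.
have : r ^+ 3 <= `|embWV S w| ^+ 3 by rewrite lerXn2r ?nnegrE// ltW.
apply/negP; rewrite -ltNge; apply: le_lt_trans cube _.
rewrite mulrC -ltr_pdivlMr//; apply: le_lt_trans x3.
by rewrite expr2 ler_piMl// ltW.
Qed.

(** The penalty replaces the constraint P v = P(U_c), which a perturbation
    of U_c violates in general. *)
Definition lyapunov c K (v : V) : R :=
  Ec c v - Ec c (embWV S (U S c)) + K * (P S v - P S (embWV S (U S c))) ^+ 2.

(** Near the critical point U_c the functional is at least half of (A x, x)
    plus K/2 times the square of DP(U_c), up to terms cubic in the V norm.
    By D2Ec_dU the linear form DP(U_c) is (A y, .) for y the derivative of c
    -> U_c, and the form is negative at y because d''(c) > 0; so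
    constrained_coercivity bounds the quadratic part from below. *)
Lemma lyapunov_ge c : Iset S c -> 0 < derive1n 2 (moment S) c ->
  exists kappa K : R, [/\ 0 < kappa, 0 < K &
    forall M, 0 < M -> exists2 rho : R, 0 < rho &
    forall w : W, `|w| <= M -> `|embW w| < rho ->
      kappa * `|embW w| ^+ 2 <= lyapunov c K (embWV S (U S c) + embWV S w) +
        K * ipX S (gen (T S) (embW (U S c))) (embW w) ^+ 2].
Proof.
move=> Ic hd; have Ov := OV_U Ic.
have [H [extH _ [A [mu [chi [Sigma [HA sA specA [[mu0 chi1 chie] taue]
  [delta d0 Sd]]]]]]]] := hA6 Ic.
set u := embWV S (U S c) in Ov *; set tau := gen _ _.
have AE x z : ipX S (A x) z = H x z by rewrite -HA.
pose y := embW (dU c).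
have Ay v : ipX S (A y) (embV S v) = frechet (P S) u v.
  by rewrite AE /y /embW extH D2Ec_dU.
have yneg : ipX S (A y) y < 0.
  by rewrite {2}/y /embW Ay -oppr_gt0 -moment_derive2.
have [k [K [k0 K0 coer]]] :=
  constrained_coercivity sA specA mu0 chi1 chie taue d0 Sd yneg.
have dE2 v : OV v -> differentiable (frechet (@Ec R S c)) v.
  by move=> /(Ec_frechet_is_diff c)[].
have dE3 := Ec_frechet2_diff c Ov.
have dE1 v : OV v -> differentiable (@Ec R S c) v.
  by move=> /(Ec_is_diff c)[].
have [C1 [r1 [C10 r10 T2]]] := taylor2 OV_open Ov dE1 dE2 dE3.
have [C2 [r2 [C20 r20 T1]]] := taylor1 OV_open Ov P_diff (P_diff2 Ov).
exists (k / 4), K; split=> //; first by rewrite divr_gt0.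
move=> M M0; pose C3 := C1 + K * C2 ^+ 2.
(* C3 |v|^3 bounds the two remainders of the Taylor expansions together. *)
have C30 : 0 < C3 by rewrite addr_gt0// mulr_gt0// exprn_gt0.
have min0 : 0 < Num.min 1 (Num.min r1 r2) by rewrite !lt_min ltr01 r10.
(* With this constant the remainders cost at most half of k/2 |x|^2. *)
have eta0 : 0 < k / (4 * C3) by rewrite divr_gt0// mulr_gt0.
have [rho rho0 interp] := interpolation M0 eta0 min0.
exists rho => // w wM wrho; have [] := interp _ wM wrho.
rewrite !lt_min; set v := embWV S w; set x := embW w => v3 /and3P[v1 vr1 vr2].
have {}T2 := T2 _ vr1; have {}T1 := T1 _ vr2.
have DEc0 : frechet (@Ec R S c) u v = 0.
  by rewrite Ec_frechet// blin_subZE critical_frechet// subrr.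
have D2 : frechet (frechet (@Ec R S c)) u v v = ipX S (A x) x.
  by rewrite AE /x /embW extH.
rewrite DEc0 D2 subr0 in T2.
have DP : frechet (P S) u v = ipX S (A y) x by rewrite -Ay.
rewrite DP in T1.
have := coer x; rewrite /lyapunov -/u.
move: T1 T2; set e1 := _ - ipX S (A y) x; set e2 := _ - 2^-1 * _.
set a := ipX S (A x) x; set g := ipX S (A y) x; set t := ipX S tau x.
have -> : P S (u + v) - P S u = g + e1 by rewrite /e1 [RHS]addrC subrK.
have -> : Ec c (u + v) - Ec c u = 2^-1 * a + e2 by rewrite /e2 [RHS]addrC subrK.
move=> he1 he2 hk.
have v0 : 0 <= `|v| by [].
have v4 : e1 ^+ 2 <= C2 ^+ 2 * `|v| ^+ 3.
  apply: (@le_trans _ _ ((C2 * `|v| ^+ 2) ^+ 2)).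
    rewrite -(real_normK (num_real e1)) ler_pXn2r ?nnegrE//.
    by rewrite mulr_ge0 ?(ltW C20)// exprn_ge0.
  rewrite exprMn ler_wpM2l ?sqr_ge0// -exprM.
  by rewrite (exprS _ 3) ler_piMl ?exprn_ge0// ltW.
have hsq : 2^-1 * g ^+ 2 - e1 ^+ 2 <= (g + e1) ^+ 2.
  rewrite -subr_ge0; have -> : (g + e1) ^+ 2 - (2^-1 * g ^+ 2 - e1 ^+ 2) =
    2^-1 * (g + 2 * e1) ^+ 2 by field.
  by rewrite mulr_ge0 ?sqr_ge0.
have h3' : C3 * `|v| ^+ 3 <= k / 4 * `|x| ^+ 2.
  rewrite mulrC -ler_pdivlMr//; apply: le_trans v3 _.
  by rewrite le_eqVlt; apply/orP; left; apply/eqP; field; rewrite gt_eqF.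
have h4' : K * (2^-1 * g ^+ 2 - e1 ^+ 2) <= K * (g + e1) ^+ 2 by rewrite ler_pM2l.
have h5' : K * e1 ^+ 2 <= K * (C2 ^+ 2 * `|v| ^+ 3) by rewrite ler_pM2l.
have h6' : - (C1 * `|v| ^+ 3) <= e2 by move: he2 => /ler_normlP[]; lra.
have h7' : 0 <= K * t ^+ 2 by rewrite mulr_ge0 ?sqr_ge0// ltW.
move: h3'; rewrite /C3 mulrDl -mulrA => h3'.
by rewrite mulrDr in hk; rewrite mulrBr in h4'; lra.
Qed.

(** * Distance to the orbit and stability *)

Definition orbit_dist c (x : X) : R :=
  inf [set `|x - T S s (embW (U S c))| | s in [set: R]].

Lemma orbit_dist_has_inf c x :
  has_inf [set `|x - T S s (embW (U S c))| | s in [set: R]].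
Proof.
split; first by exists `|x - T S 0 (embW (U S c))|, 0.
by exists 0 => _ [s _ <-].
Qed.

Lemma orbit_dist_le c x s : orbit_dist c x <= `|x - T S s (embW (U S c))|.
Proof. by apply: ge_inf; [exact: (orbit_dist_has_inf c x).2|exists s]. Qed.

Lemma orbit_dist_ge0 c x : 0 <= orbit_dist c x.
Proof. by apply: lb_le_inf; [exact: (orbit_dist_has_inf c x).1|move=> _ [s _ <-]]. Qed.

Lemma orbit_dist_lt c x r : orbit_dist c x < r ->
  exists s, `|x - T S s (embW (U S c))| < r.
Proof. by move=> /inf_lt[|_ [s _ <-] h]; [exact: (orbit_dist_has_inf c x).1|exists s]. Qed.

Lemma orbit_dist_lip c x y : orbit_dist c x <= orbit_dist c y + `|x - y|.
Proof.
apply/ler_addgt0Pr => e e0.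
have [|s hs] := @orbit_dist_lt c y (orbit_dist c y + e); first by rewrite ltrDl.
apply: le_trans (orbit_dist_le c x s) _.
have -> : x - T S s (embW (U S c)) = (x - y) + (y - T S s (embW (U S c))).
  by rewrite addrA subrK.
by apply: le_trans (ler_normD _ _) _; lra.
Qed.

Lemma orbit_shift c x s :
  `|T S (- s) x - embW (U S c)| = `|x - T S s (embW (U S c))|.
Proof. by rewrite -[embW _ in LHS](lift_K liftX s) (lift_dist liftX). Qed.

(** If s nearly minimizes r -> |x - T(r) U_c|^2, comparison with s + k and s
    - k, for k of a small fixed size h, shows that the derivative of this
    function at s is small. This derivative is -2 times the inner product
    below. An arbitrarily small error is harmless in lyapunov_ge. *)
Lemma almost_minimizer c x e : Iset S c -> 0 < e -> exists s,
  `|x - T S s (embW (U S c))| < orbit_dist c x + e /\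
  `|ipX S (gen (T S) (embW (U S c))) (T S (- s) x - embW (U S c))| <= e.
Proof.
move=> Ic e0; set u := embW (U S c); set tau := gen _ _; set D := orbit_dist c x.
have D0 : 0 <= D by exact: orbit_dist_ge0.
pose N := D + 1; have N0 : 0 < N by rewrite ltr_wpDl.
(* Here eta, h and e' control the three errors, namely the remainder of the
   expansion of T(k) u, its quadratic term and the defect of minimality:
   each becomes small against h e. *)
pose eta := e / (4 * N); have eta0 : 0 < eta by rewrite divr_gt0// mulr_gt0.
have etaN : 4 * (N * eta) = e by rewrite /eta; field; rewrite gt_eqF.
have [dl dl0 tan] : exists2 dl : R, 0 < dl & forall h, `|h| < dl ->
    `|T S h u - u - h *: tau| <= eta * `|h|.
  have /cvg_ex[l hl] := domT'_U Ic.
  have lE : tau = l by exact: cvg_lim.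
  move: hl => /cvgrPdist_lt/(_ _ eta0).
  rewrite /dnbhs/= => /nbhs_normP[dl /= dl0 hdl]; exists dl => // h hh.
  have [->|hn0] := eqVneq h 0.
    by rewrite (lift_0 liftX) subrr scale0r subrr !normr0 mulr0.
  have := hdl h; rewrite /= sub0r normrN => /(_ hh hn0); rewrite -lE => /ltW h1.
  have -> : T S h u - u - h *: tau = - (h *: (tau - h^-1 *: (T S h u - u))).
    by rewrite scalerBr scalerA divff// scale1r opprB.
  by rewrite normrN normrZ mulrC ler_wpM2r.
pose q := `|tau| + eta; have q0 : 0 < q by rewrite ltr_wpDl.
pose h := Num.min (dl / 2) (e / (2 * q ^+ 2)).
have q20 : 0 < 2 * q ^+ 2 by rewrite mulr_gt0// exprn_gt0.
have hp : 0 < h by rewrite lt_min !divr_gt0.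
have hdl : h < dl by rewrite gt_min ltr_pdivrMr// ltr_pMr// ltr1n.
have hq : h * (2 * q ^+ 2) <= e by rewrite -ler_pdivlMr// ge_min lexx orbT.
pose e' := Num.min (Num.min e 1) (h * e / (2 * D + 1)).
have D1 : 0 < 2 * D + 1 by rewrite ltr_wpDl// mulr_ge0.
have e'0 : 0 < e' by rewrite !lt_min e0 ltr01 divr_gt0// mulr_gt0.
have [e'e e'1 e'h] : [/\ e' <= e, e' <= 1 & e' * (2 * D + 1) <= h * e].
  split; [by rewrite !ge_min lexx|by rewrite !ge_min lexx orbT|].
  by rewrite -ler_pdivlMr// ge_min lexx orbT.
have [|s hs] := @orbit_dist_lt c x (D + e'); first by rewrite ltrDl.
exists s; split; first by apply: lt_le_trans hs _; rewrite lerD2l.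
have [z Ez] : exists z, T S (- s) x - u = z by exists (T S (- s) x - u).
rewrite Ez.
have zE : `|z| < D + e' by rewrite -Ez /u orbit_shift.
have z2 : `|z| ^+ 2 - D ^+ 2 <= h * e.
  apply: le_trans e'h.
  have : `|z| ^+ 2 <= (D + e') ^+ 2.
    by rewrite ler_pXn2r ?nnegrE// ?(ltW zE)// addr_ge0// ltW.
  have : e' ^+ 2 <= e' by rewrite expr2 ler_piMl// ltW.
  by rewrite sqrrD mulr2n; lra.
have zN : `|z| <= N by rewrite /N; lra.
have one k : `|k| = h -> k * ipX S tau z <= h * e.
  move=> kh; have := tan k; rewrite kh => /(_ hdl).
  have [rho Erho] : exists rho, T S k u - u - k *: tau = rho by eexists.
  rewrite Erho => hrho.
  have far : D <= `|z - (k *: tau + rho)|.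
    have -> : z - (k *: tau + rho) = T S (- s) x - T S k u.
      by rewrite -Erho [k *: tau + _]addrC subrK -Ez opprB addrA subrK.
    rewrite -(lift_dist liftX s) (lift_NK liftX) -T_D; exact: orbit_dist_le.
  have far2 : D ^+ 2 <= `|z| ^+ 2 - 2 * (k * ipX S tau z + ipX S z rho) + `|k *: tau + rho| ^+ 2.
    have -> : `|z| ^+ 2 - 2 * (k * ipX S tau z + ipX S z rho) + `|k *: tau + rho| ^+ 2
        = `|z - (k *: tau + rho)| ^+ 2.
      by rewrite -!(ip_norm (ipX S)) !ipE (ip_sym (ipX S) z tau) (ip_sym (ipX S) rho z); ring.
    by rewrite ler_pXn2r ?nnegrE.
  have d2 : `|k *: tau + rho| ^+ 2 <= (h * q) ^+ 2.
    have hq0 : 0 <= h * q by rewrite mulr_ge0// ltW.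
    rewrite ler_pXn2r ?nnegrE//.
    apply: le_trans (ler_normD _ _) _; rewrite normrZ kh /q mulrDr lerD2l.
    by rewrite mulrC.
  have zrho : - (N * (eta * h)) <= ipX S z rho.
    have : `|ipX S z rho| <= N * (eta * h).
      by apply: le_trans (ip_cauchy_schwarz _ _ _) _; apply: ler_pM.
    by move=> /ler_normlP[]; lra.
  have e1 : N * (eta * h) = h * e / 4 by rewrite -etaN; field.
  have e2 : (h * q) ^+ 2 <= h * e / 2.
    have -> : (h * q) ^+ 2 = h * (h * (2 * q ^+ 2)) / 2 by field.
    by rewrite ler_pM2r// ler_pM2l.
  by rewrite e1 in zrho; lra.
rewrite ler_norml; apply/andP; split.
  have := one (- h); rewrite normrN gtr0_norm// => /(_ erefl).
  by rewrite mulNr lerNl -mulrN ler_pM2l// lerNl.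
by have := one h; rewrite gtr0_norm// ler_pM2l// => /(_ erefl).
Qed.

(** The claim amounts to a bound of T(s1 + s) U_c in W. That vector is close
    to T(s1) w in X, so its affine part T(s1 + s) 0 is bounded in X, hence
    in W through omega. *)
Lemma orbit_W_bound c r : exists2 M : R, 0 < M & forall w s s1,
  `|TW S s1 w| < r -> `|embW w - T S s (embW (U S c))| <= 1 ->
  `|TW S (- s) w - U S c| <= M.
Proof.
have [K1 K10 eV] := blin_bounded (embV S); have [K2 K20 eW] := blin_bounded (embWV S).
have [omega [om0 om_incr om]] : exists omega : R -> R,
    [/\ forall r, 0 <= r -> 0 <= omega r,
        forall r r', 0 <= r -> r <= r' -> omega r <= omega r' &
        forall s, `|TW S s 0| <= omega `|T S s 0| ].
  by case: hA4 => _ [_ [[_ h] _ _ _ _]].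
set u := embW (U S c); pose a := `|u| + (K1 * (K2 * `|r|) + 1).
have a0 : 0 <= a by rewrite addr_ge0// addr_ge0// mulr_ge0 ?(ltW K10)// mulr_ge0// ltW.
exists (`|r| + (`|U S c| + omega a) + 1).
  by rewrite ltr_wpDl// addr_ge0// addr_ge0// om0.
move=> w s s1 wr ws.
have -> : `|TW S (- s) w - U S c| = `|TW S s1 w - TW S (s1 + s) (U S c)|.
  rewrite -[U S c in LHS](lift_K liftW s) (lift_dist liftW).
  by rewrite (lift_D liftW) (lift_dist liftW).
set q := s1 + s.
have h1 : `|T S q u| <= K1 * (K2 * `|r|) + 1.
  have -> : T S q u = embW (TW S s1 w) - (T S s1 (embW w) - T S s1 (T S s u)).
    by rewrite -T_D embW_TW opprB addrC subrK.
  apply: le_trans (ler_normB _ _) _; apply: lerD; last by rewrite (lift_dist liftX).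
  apply: le_trans (eV _) _; rewrite ler_pM2l//.
  apply: le_trans (eW _) _; rewrite ler_pM2l//.
  by apply: le_trans (ler_norm r); exact: ltW.
have h2' : `|T S q 0| <= a.
  have -> : T S q 0 = - (T S q u - T S q 0) + T S q u by rewrite opprB subrK.
  by apply: le_trans (ler_normD _ _) _; rewrite normrN dT_norm lerD2l.
have h3' : `|TW S q (U S c)| <= `|U S c| + omega a.
  rewrite -[TW S q _](subrK (TW S q 0)); apply: le_trans (ler_normD _ _) _.
  by rewrite dTW_norm lerD2l; apply: le_trans (om q) _; exact: om_incr.
apply: le_trans (ler_normB _ _) _.
have := le_trans (ltW wr) (ler_norm r); lra.
Qed.

Lemma lyapunov_invariant c K s v : OV v -> lyapunov c K (TV S s v) = lyapunov c K v.
Proof.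
move=> Ov; rewrite /lyapunov /Ec P_invariant//.
by case: hA4 => _ [_ [_ _ _ _ ->]].
Qed.

Lemma lyapunov_lt c K M e : Iset S c -> 0 < M -> 0 < e -> exists2 rho : R, 0 < rho &
  forall w : W, `|w| <= M -> `|embW w| < rho ->
    lyapunov c K (embWV S (U S c) + embWV S w) < e.
Proof.
move=> Ic M0 e0; have Ov := OV_U Ic; set u := embWV S (U S c) in Ov *.
have L0 : lyapunov c K u = 0 by rewrite /lyapunov !subrr expr0n/= mulr0 addr0.
have cL : lyapunov c K v @[v --> u] --> lyapunov c K u.
  have cP : P S v @[v --> u] --> P S u by exact: differentiable_continuous (P_diff Ov).
  have cE : E S v @[v --> u] --> E S u by exact: differentiable_continuous (E_diff Ov).
  apply: cvgD.
    apply: cvgB; last exact: cvg_cst.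
    by apply: cvgB => //; apply: cvgMl_tmp.
  apply: cvgMl_tmp; rewrite expr2.
  by apply: cvgM; apply: cvgB => //; exact: cvg_cst.
move: cL => /cvgrPdist_lt/(_ _ e0)/nbhs_normP[r /= r0 hr].
have [rho rho0 h] := interpolation M0 ltr01 r0.
exists rho => // w wM wrho; have [_ vr] := h w wM wrho.
have := hr (u + embWV S w); rewrite /= opprD addrA subrr sub0r normrN => /(_ vr).
by rewrite L0 sub0r normrN => /ltr_normlP[].
Qed.

Lemma orbit_dist_continuous c : continuous (orbit_dist c).
Proof.
move=> x; apply/cvgrPdist_lt => e e0; have := near_norm x e0.
apply: filterS => y xy; apply: le_lt_trans xy; rewrite ler_norml; apply/andP; split.
  by have := orbit_dist_lip c y x; rewrite distrC; lra.
by have := orbit_dist_lip c x y; lra.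
Qed.

(** A solution whose distance to the orbit reached m / 2 would have lyapunov
    at least b at that time, whereas the conserved value of lyapunov is
    below b for initial data close to the orbit. *)
Lemma orbital_stability c : Iset S c -> 0 < derive1n 2 (moment S) c ->
  conditionally_orbitally_stable S c.
Proof.
move=> Ic hd r rho r0 rho_gt0; set u0 := embW (U S c).
have [kappa [K [kappa0 K0 Lge]]] := lyapunov_ge Ic hd.
have [M M0 MB] := orbit_W_bound c r.
have [rho1 rho10 {}Lge] := Lge _ M0.
pose m := Num.min (Num.min rho rho1) 1; have m0 : 0 < m by rewrite !lt_min rho_gt0 rho10 ltr01.
have [m_rho m_rho1 m1] : [/\ m <= rho, m <= rho1 & m <= 1].
  by split; rewrite ?ge_min ?lexx ?orbT// ge_min lexx ?orbT.
pose b := kappa * (m / 2) ^+ 2; have b0 : 0 < b by rewrite mulr_gt0// exprn_gt0// divr_gt0.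
have [rho3 rho30 Llt] := lyapunov_lt K Ic M0 b0.
(* States near the orbit are moved close to U_c itself by the group. *)
have move_near w s d : ball_mod_T r w -> `|embW w - T S s u0| < d -> d <= m ->
  let w' := TW S (- s) w - U S c in
  [/\ `|w'| <= M, embW w' = T S (- s) (embW w) - u0, `|embW w'| = `|embW w - T S s u0| &
     lyapunov c K (embWV S (U S c) + embWV S w') = lyapunov c K (embWV S w)].
  move=> [Ow iw] wd dm w'.
  have [s1 s1r] : exists s1, `|TW S s1 w| < r.
    have ne : [set `|TW S s w| | s in [set: R]] !=set0 by exists `|TW S 0 w|, 0.
    by have [_ [s1 _ <-] s1r] := inf_lt ne iw; exists s1.
  have Ew' : embW w' = T S (- s) (embW w) - u0 by rewrite /embW !blinB -/(embW _) embW_TW.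
  split => //.
  - by apply: MB s1r _; apply: le_trans m1; apply: le_trans dm; exact: ltW.
  - by rewrite Ew' orbit_shift.
  - by rewrite blinB addrC subrK embWV_TW lyapunov_invariant.
(* The bound of lyapunov_ge with the error of almost_minimizer sent to 0. *)
have lower w : ball_mod_T r w -> orbit_dist c (embW w) < m ->
    kappa * orbit_dist c (embW w) ^+ 2 <= lyapunov c K (embWV S w).
  move=> bw; set D := orbit_dist c _ => Dm; apply/ler_addgt0Pr => e e0.
  pose eps := Num.min (Num.min 1 (e / K)) (m - D).
  have eps0 : 0 < eps by rewrite !lt_min ltr01 divr_gt0// subr_gt0.
  have [eps1 epsK epsm] : [/\ eps <= 1, eps * K <= e & D + eps <= m].
    split; first by rewrite !ge_min lexx.
      by rewrite -ler_pdivlMr// !ge_min lexx orbT.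
    by rewrite -lerBrDl ge_min lexx orbT.
  have [s [hs hp]] := almost_minimizer (embW w) Ic eps0.
  have [wM Ew' nw' <-] := move_near w s _ bw hs epsm.
  have := Lge _ wM; rewrite nw' => /(_ (lt_le_trans hs (le_trans epsm m_rho1))).
  rewrite Ew'; set t := ipX S _ _ => h.
  have t2 : K * t ^+ 2 <= e.
    apply: le_trans epsK; rewrite [leRHS]mulrC ler_pM2l//.
    apply: (@le_trans _ _ (eps ^+ 2)); last by rewrite expr2 ler_piMl// ltW.
    by rewrite -(real_normK (num_real t)) ler_pXn2r ?nnegrE// ltW.
  have D2 : kappa * D ^+ 2 <= kappa * `|embW w - T S s u0| ^+ 2.
    rewrite ler_pM2l// ler_pXn2r ?nnegrE ?orbit_dist_ge0//.
    exact: orbit_dist_le.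
  by apply: le_trans D2 (le_trans h _); rewrite lerD2l.
exists (Num.min (m / 2) rho3); first by rewrite lt_min divr_gt0.
move=> t0 w0 u t00 [[Ou cu _ Econs Pcons] u0E] bu [_ hw0] t tI.
have I0 : time_interval t0 0 by split; [exact: lexx|exact: t00].
split; first exact: Ou.
rewrite -/(orbit_dist c (embW w0)) in hw0.
rewrite -/(orbit_dist c (embW (u t))).
have Lcons s : time_interval t0 s -> lyapunov c K (embWV S (u s)) < b.
  move=> sI; have -> : lyapunov c K (embWV S (u s)) = lyapunov c K (embWV S w0).
    by rewrite /lyapunov /Ec (Econs s 0)// (Pcons s 0)// u0E.
  have b0' := bu _ I0; rewrite u0E in b0'.
  have [s' hs'] := orbit_dist_lt hw0.
  move: (hs'); rewrite lt_min => /andP[_ hs3].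
  have [|wM _ nw' <-] := move_near w0 s' _ b0' hs'.
    by rewrite ge_min; apply/orP; left; lra.
  by apply: Llt => //; rewrite nw'.
rewrite ltNge; apply/negP => far.
have [t_ge0 t_lt] := tI.
pose D s := orbit_dist c (embW (u s)).
have cD : {within `[0, t], continuous D}.
  have sub : `[0, t] `<=` time_interval t0.
    move=> s; rewrite /= in_itv/= => /andP[s0 st]; split => //.
    by apply: le_lt_trans t_lt; rewrite lee_fin.
  have cu' := continuous_subspaceW sub cu.
  apply: (@within_continuous_comp R W _ u (orbit_dist c \o @embW R S)) => //.
  move=> w; apply: (@continuous_comp _ _ _ (@embW R S) (orbit_dist c)).
    exact: embW_continuous.
  exact: orbit_dist_continuous.
have D0 : D 0 < m / 2 by rewrite /D u0E; move: hw0; rewrite lt_min => /andP[].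
have Dt : m / 2 <= D t by rewrite /D; apply: le_trans far; apply: le_trans m_rho; lra.
have [|s] := IVT t_ge0 cD (v := m / 2).
  by rewrite ge_min (ltW D0) /= le_max Dt orbT.
rewrite in_itv/= => /andP[s0 st] Ds.
have sI : time_interval t0 s.
  by split => //; apply: le_lt_trans t_lt; rewrite lee_fin.
have := lower _ (bu _ sI); rewrite -/(D s) Ds => /(_ _).
have -> : m / 2 < m by lra.
by move=> /(_ isT); rewrite leNgt Lcons.
Qed.

End Setting.

Theorem theorem2p4 (R : realType) (S : setting R)
  (h0 : assumption_spaces S)
  (h1 : assumption1 S)
  (h2 : assumption2 S)
  (h3 : assumption3 S)
  (h4 : assumption4 S)
  (h5 : assumption5 S)
  (h6 : assumption6 S)
  (c : R) (hc : Iset S c)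
  (hd : 0 < derive1n 2 (moment S) c) :
  conditionally_orbitally_stable S c.
Proof. exact: orbital_stability. Qed.
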